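(* Let $H$ be a separable complex Hilbert space with $\dim H\ge 2$ and let $T\in B(H)$. If the range $\mathrm{ran}\,T$ is not closed or $\mathrm{ind}\,T\le 0$, then $$\mathrm{dist}(T,\mathbb{C}\mathcal{V})=\frac{\|T\|-m(T)}{2}=\frac{1-\sqrt{\frac{1-\hat{\varepsilon}(T)}{1+\hat{\varepsilon}(T)}}}{2}\,\|T\|.$$
   Context: $B(H)$ is the set of bounded linear operators on $H$, with operator norm $\|\cdot\|$. $\mathrm{ind}\,T=\dim\ker T-\dim\ker T^{*}$, where $\dim$ is Hilbert space dimension, and $\mathrm{ind}\,T\le 0$ means $\dim\ker T\le\dim\ker T^{*}$. $\mathcal{V}\subseteq B(H)$ is the set of all (linear) isometries on $H$, $\mathbb{C}\mathcal{V}=\{\lambda V:\lambda\in\mathbb{C},V\in\mathcal{V}\}$, and $\mathrm{dist}(T,\mathcal{S})=\inf_{S\in\mathcal{S}}\|T-S\|$. The minimum modulus is $m(T)=\inf\{\|Tx\|:\|x\|=1\}$. For $\varepsilon\in[0,1]$, $T\in B(H)$ is $\varepsilon$-AOP if $\langle x,y\rangle=0$ implies $|\langle Tx,Ty\rangle|\le\varepsilon\|Tx\|\,\|Ty\|$ for all $x,y\in H$; $\hat{\varepsilon}(T)=\inf\{\varepsilon\in[0,1]:T\text{ is }\varepsilon\text{-AOP}\}$. *)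

(* Defs.v *)
From HB Require Import structures.
From mathcomp Require Import all_boot all_order all_algebra sesquilinear.
From mathcomp Require Import complex.
From mathcomp Require Import all_classical all_reals.
From mathcomp Require Import topology normedtype.

Set Implicit Arguments.
Unset Strict Implicit.
Unset Printing Implicit Defensive.

Import Order.TTheory GRing.Theory Num.Theory.
Local Open Scope classical_set_scope.
Local Open Scope card_scope.
Local Open Scope complex_scope.
Local Open Scope ring_scope.

Section Hilbert.
Variables (R : realType) (H : completeNormedModType R[i]).
Variable (dot : {dot H for @Num.conj R[i]}).

(* A Hilbert space is a complete normed space over [R[i]] whose norm is the one
   induced by a (positive definite, Hermitian) inner product.  As usual for
   [{dot _ for _}], the form is linear in its first argument. *)
Definition norm_induced_by := forall x : H, dot x x = `|x| ^+ 2.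

(* In an [R[i]]-normed module, [`|x|] is an element of [R[i]] (with zero
   imaginary part); its real part is the norm as an element of [R]. *)
Definition rnorm (x : H) : R := complex.Re `|x|.

Definition separable := exists2 D : set H, countable D & dense D.

Definition linspan (E : set H) : set H :=
  [set x | exists n (c : 'I_n -> R[i]) (e : 'I_n -> H),
     (forall k, E (e k)) /\ x = \sum_(k < n) c k *: e k].

Definition orthonormal_set (E : set H) :=
  (forall x, E x -> `|x| = 1) /\
  (forall x y, E x -> E y -> x <> y -> dot x y = 0).

Definition orthonormal_basis (M E : set H) :=
  orthonormal_set E /\ closure (linspan E) = M.

(* The Hilbert space dimension of a closed subspace is the cardinal of any of
   its orthonormal bases (all of them are equipotent). *)
Definition hdim_le (M N : set H) :=
  exists E F, [/\ orthonormal_basis M E, orthonormal_basis N F & E #<= F].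

Definition hdim_ge (M : set H) (n : nat) :=
  exists2 E, orthonormal_basis M E & `I_n #<= E.

Definition bounded_operator (T : H -> H) :=
  exists M : R, forall x, rnorm (T x) <= M * rnorm x.

(* The value at [y] is the unique [z] (provided by Riesz' theorem when [T] is
   bounded and linear) such that [dot (T x) y = dot x z] for all [x]. *)
Definition adjoint (T : H -> H) : H -> H :=
  fun y => xget 0 [set z | forall x, dot (T x) y = dot x z].

Definition ker (T : H -> H) : set H := T @^-1` [set 0].

Definition index_le0 (T : H -> H) := hdim_le (ker T) (ker (adjoint T)).

Definition opnorm (T : H -> H) : R :=
  sup [set rnorm (T x) | x in [set x : H | rnorm x <= 1]].

Definition min_modulus (T : H -> H) : R :=
  inf [set rnorm (T x) | x in [set x : H | rnorm x = 1]].

Definition op_dist (T : H -> H) (S : set (H -> H)) : R :=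
  inf [set opnorm (T \- A) | A in S].

Definition isometries : set (H -> H) :=
  [set V | linear V /\ forall x, `|V x| = `|x|].

Definition scaled_isometries : set (H -> H) :=
  [set a \*: V | a in [set: R[i]] & V in isometries].

Definition AOP (eps : R) (T : H -> H) :=
  forall x y, dot x y = 0 ->
    `|dot (T x) (T y)| <= eps%:C * `|T x| * `|T y|.

Definition AOP_const (T : H -> H) : R :=
  inf [set eps | 0 <= eps <= 1 /\ AOP eps T].

End Hilbert.

Arguments isometries {R} H _.
Arguments scaled_isometries {R} H _.

(* Main.v *)
Require Import Defs.
From HB Require Import structures.
From mathcomp Require Import all_boot all_order all_algebra sesquilinear.
From mathcomp Require Import complex.
From mathcomp Require Import all_classical all_reals.
From mathcomp Require Import topology normedtype.
From mathcomp Require Import sequences ring lra.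

Import Order.TTheory GRing.Theory Num.Theory.
Import numFieldNormedType.Exports.
Local Open Scope classical_set_scope.
Local Open Scope complex_scope.
Local Open Scope ring_scope.

(** Write M = ||T|| and m = m(T).

    If T is bounded below, its polar decomposition T = V P has V an isometry
    and m <= P <= M, hence ||T - cV|| = ||P - c|| <= (M - m)/2 for
    c = (M + m)/2; conversely ||T - aV|| >= max(M - |a|, |a| - m) for every
    isometry V. If m = 0, it is enough to approximate T in norm by operators
    that are bounded below. To this end T is replaced by a small multiple of
    an isometry W on a subspace E where T is small, T being bounded below on
    the orthogonal complement of E. If T is bounded below on the complement
    of ker T, its range is closed, so that ind T <= 0 holds and one takes
    E = ker T and W : ker T -> ker T*. Otherwise E is the spectral subspace of
    T*T for [0, d^2]; then T E is infinite-dimensional and orthogonal to the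
    image of the complement of E, so it can receive W since H is separable.

    For the second equality, T is eps-AOP iff
    (1 - eps)|Tu|^2 <= (1 + eps)|Tv|^2 for all unit vectors u and v. *)

Set Implicit Arguments.
Unset Strict Implicit.
Unset Printing Implicit Defensive.

(** * Real inner product and convergence *)

Section InnerProduct.
Variables (R : realType) (H : completeNormedModType R[i]).
Variable (dot : {dot H for @Num.conj R[i]}).
Hypothesis dotE : norm_induced_by dot.
Implicit Types (x y z : H) (a : R[i]) (r : R).

Definition re_dot x y : R := complex.Re (dot x y).

Local Notation rdot := re_dot.

Lemma normE x : `|x| = (rnorm x)%:C.
Proof. by rewrite /rnorm RRe_real // ger0_real. Qed.

Lemma rnorm_ge0 x : 0 <= rnorm x.
Proof. by rewrite -ler0c -normE. Qed.

Lemma normCE a : `|a| = (complex.Re `|a|)%:C.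
Proof. by rewrite RRe_real // ger0_real. Qed.

Lemma rnormZ a x : rnorm (a *: x) = complex.Re `|a| * rnorm x.
Proof. by apply: complexI; rewrite rmorphM /= -normCE -!normE normrZ. Qed.

Lemma rnormZr r x : rnorm (r%:C *: x) = `|r| * rnorm x.
Proof. by rewrite rnormZ normc_def /= expr0n addr0 sqrtr_sqr. Qed.

Lemma rnorm0 : rnorm (0 : H) = 0.
Proof. by rewrite /rnorm normr0. Qed.

Lemma rnorm_eq0 x : (rnorm x == 0) = (x == 0).
Proof. by rewrite -(normr_eq0 x) normE -(inj_eq (@complexI R)). Qed.

Lemma rnormN x : rnorm (- x) = rnorm x.
Proof. by rewrite /rnorm normrN. Qed.

Lemma rnormBC x y : rnorm (x - y) = rnorm (y - x).
Proof. by rewrite -opprB rnormN. Qed.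

Lemma rnormD x y : rnorm (x + y) <= rnorm x + rnorm y.
Proof. by rewrite -lecR rmorphD /= -!normE ler_normD. Qed.

Lemma rnormB x y : rnorm x - rnorm y <= rnorm (x - y).
Proof. by rewrite lerBlDr -{1}[x](subrK y) rnormD. Qed.

Lemma rdotDl x y z : rdot (x + y) z = rdot x z + rdot y z.
Proof. by rewrite /rdot linearDl raddfD. Qed.

Lemma rdotDr x y z : rdot x (y + z) = rdot x y + rdot x z.
Proof. by rewrite /rdot linearDr raddfD. Qed.

Lemma dotC x y : dot x y = (dot y x)^*%C.
Proof. by rewrite hermC expr0 mul1r. Qed.

Lemma dotZr a x y : dot x (a *: y) = (a^*)%C * dot x y.
Proof. by rewrite linearZr_LR. Qed.

Lemma dotZl a x y : dot (a *: x) y = a * dot x y.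
Proof. by rewrite linearZl_LR. Qed.

Lemma dotDl x y z : dot (x + y) z = dot x z + dot y z.
Proof. exact: linearDl. Qed.

Lemma dotDr x y z : dot x (y + z) = dot x y + dot x z.
Proof. exact: linearDr. Qed.

Lemma dotBl x y z : dot (x - y) z = dot x z - dot y z.
Proof. exact: linearBl. Qed.

Lemma dotBr x y z : dot x (y - z) = dot x y - dot x z.
Proof. exact: linearBr. Qed.

Lemma dot0l x : dot 0 x = 0.
Proof. exact: linear0l. Qed.

Lemma dot0r x : dot x 0 = 0.
Proof. exact: linear0r. Qed.

Lemma rdotC x y : rdot x y = rdot y x.
Proof. by rewrite /rdot dotC; case: (dot y x). Qed.

Lemma rdotNl x y : rdot (- x) y = - rdot x y.
Proof. by rewrite /rdot linearNl raddfN. Qed.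

Lemma rdotNr x y : rdot x (- y) = - rdot x y.
Proof. by rewrite rdotC rdotNl rdotC. Qed.

Lemma rdotZl r x y : rdot (r%:C *: x) y = r * rdot x y.
Proof.
by rewrite /rdot dotZl; case: (dot x y) => u v /=; rewrite mul0r subr0.
Qed.

Lemma rdotZr r x y : rdot x (r%:C *: y) = r * rdot x y.
Proof. by rewrite rdotC rdotZl rdotC. Qed.

Lemma rdotxx x : rdot x x = rnorm x ^+ 2.
Proof. by rewrite /rdot dotE normE -rmorphXn. Qed.

Definition rdotE := (rdotDl, rdotDr, rdotNl, rdotNr, rdotZl, rdotZr).

Lemma rnorm_sqrD x y :
  rnorm (x + y) ^+ 2 = rnorm x ^+ 2 + rnorm y ^+ 2 + 2 * rdot x y.
Proof. by rewrite -!rdotxx !rdotE (rdotC y x); ring. Qed.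

Lemma rnorm_sqrB x y :
  rnorm (x - y) ^+ 2 = rnorm x ^+ 2 + rnorm y ^+ 2 - 2 * rdot x y.
Proof. by rewrite rnorm_sqrD rnormN rdotNr; ring. Qed.

Lemma rdot0l y : rdot 0 y = 0.
Proof. by rewrite -(scaler0 _ (0%:C)) rdotZl mul0r. Qed.

Lemma rdot0r y : rdot y 0 = 0.
Proof. by rewrite rdotC rdot0l. Qed.

Lemma rnorm_gt0 x : (0 < rnorm x) = (x != 0).
Proof. by rewrite lt_def rnorm_eq0 rnorm_ge0 andbT. Qed.

Lemma rdot_le x y : `|rdot x y| <= rnorm x * rnorm y.
Proof.
have [->|y0] := eqVneq y 0; first by rewrite rnorm0 mulr0 rdot0r normr0.
have [->|x0] := eqVneq x 0; first by rewrite rnorm0 mul0r rdot0l normr0.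
(* Expanding the squared norm of ‖y‖x - e‖x‖y gives a bound for each sign; e = 1 and e = -1 together
   bound the absolute value. *)
have h (e : R) : e ^+ 2 = 1 -> e * rdot x y <= rnorm x * rnorm y.
  move=> e1.
  have := sqr_ge0 (rnorm ((rnorm y)%:C *: x - (e * rnorm x)%:C *: y)).
  rewrite rnorm_sqrB !rdotE !rnormZr !exprMn !real_normK ?num_real // !exprMn e1.
  rewrite [X in 0 <= X](_ : _ = (2 * rnorm y * rnorm x) *
    (rnorm x * rnorm y - e * rdot x y)); last by ring.
  by rewrite pmulr_rge0 ?subr_ge0 // !mulr_gt0 // rnorm_gt0.
rewrite ler_norml -[X in X && _]lerN2 opprK; apply/andP; split.
  by rewrite -mulN1r h // sqrrN expr1n.
by rewrite -[rdot x y]mul1r h // expr1n.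
Qed.

Lemma phase_exists a : exists2 u : R[i], `|u| = 1 & u * a = `|a|.
Proof.
have [->|a0] := eqVneq a 0; first by exists 1; rewrite ?normr1 // mulr0 normr0.
exists (`|a| / a); last by rewrite divfK.
by rewrite normf_div normr_id divff // normr_eq0.
Qed.

(** For a suitable phase [a] the real part equals the modulus of [dot x y]. This recovers complex
    orthogonality from arguments about real parts. *)
Lemma rdotZ_eq0 x y : (forall a, rdot (a *: x) y = 0) -> dot x y = 0.
Proof.
move=> h; have [u _ ux] := phase_exists (dot x y).
apply/eqP; rewrite -normr_eq0 normCE -ux -dotZl.
by have := h u; rewrite /rdot => ->.
Qed.

Lemma dot0_rdot x y : dot x y = 0 -> rdot x y = 0.
Proof. by rewrite /rdot => ->. Qed.

Lemma rnorm_sqrD0 x y :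
  dot x y = 0 -> rnorm (x + y) ^+ 2 = rnorm x ^+ 2 + rnorm y ^+ 2.
Proof. by move=> /dot0_rdot xy; rewrite rnorm_sqrD xy mulr0 addr0. Qed.

Lemma dot_eq0C x y : dot x y = 0 -> dot y x = 0.
Proof. by rewrite (dotC y) => ->; rewrite conjc0. Qed.

Lemma dot_self0 x : dot x x = 0 -> x = 0.
Proof.
by move=> /dot0_rdot; rewrite rdotxx => /eqP; rewrite sqrf_eq0 rnorm_eq0 => /eqP.
Qed.

Lemma dot_le x y : `|dot x y| <= (rnorm x * rnorm y)%:C.
Proof.
have [u u1 uxy] := phase_exists (dot x y).
rewrite -uxy -dotZl.
have -> : dot (u *: x) y = (rdot (u *: x) y)%:C.
  by rewrite /rdot dotZl uxy -normCE.
rewrite lecR; apply: le_trans (ler_norm _) _.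
by apply: le_trans (rdot_le _ _) _; rewrite rnormZ u1 mul1r.
Qed.

Lemma rdot_eq x y : (forall z, rdot z x = rdot z y) -> x = y.
Proof.
move=> h; apply/eqP; rewrite -subr_eq0 -rnorm_eq0 -sqrf_eq0 -rdotxx.
by rewrite rdotDr rdotNr h subrr.
Qed.

Lemma cvg_rnormP (u : nat -> H) (l : H) :
  (u @ \oo --> l) <-> (fun n => rnorm (l - u n)) @ \oo --> (0 : R).
Proof.
split.
  move=> /cvgrPdist_lt ul; apply/cvgrPdist_lt => e e0.
  have e0' : 0 < e%:C by rewrite ltcR.
  apply: filterS (ul _ e0') => n; rewrite normE ltcR sub0r normrN.
  by rewrite ger0_norm // rnorm_ge0.
move=> /cvgrPdist_lt ul; apply/cvgrPdist_lt => -[e e'].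
rewrite ltcE /= => /andP[/eqP -> e0].
apply: filterS (ul _ e0) => n; rewrite normE -[e +i* 0]/(e%:C) ltcR sub0r normrN.
by rewrite ger0_norm // rnorm_ge0.
Qed.

Lemma rnorm_complete (u : nat -> H) :
  (forall e : R, 0 < e -> exists N, forall n, (N <= n)%N ->
     rnorm (u n - u N) < e) -> exists l : H, u @ \oo --> l.
Proof.
move=> cu; suff /cauchy_cvgP/cvg_ex[l ul] : cauchy (fmap u \oo) by exists l.
apply: cauchy_exP => -[e e']; rewrite ltcE /= => /andP[/eqP -> e0].
have [N hN] := cu _ e0; exists (u N); exists N => // n /= /hN.
by rewrite -ball_normE /= normE -[e +i* 0]/(e%:C) ltcR rnormBC.
Qed.

(** A term within [e] of the supremum serves as [N]. Sequences of vectors whose increments are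
    controlled by such an [s] are then Cauchy. *)
Lemma bounded_monotone_cauchy (s : nat -> R) (K : R) :
  {homo s : m n / (m <= n)%N >-> m <= n} -> (forall n, s n <= K) ->
  forall e, 0 < e -> exists N, forall n, (N <= n)%N -> s n - s N < e.
Proof.
move=> hs sK e e0.
have sup_s : has_sup (range s).
  by split; [exists (s 0%N), 0%N | exists K => _ [n _ <-]].
have [_ [N _ <-] hN] := sup_adherent e0 sup_s.
exists N => n Nn; have := ub_le_sup sup_s.2 (imageT s n); lra.
Qed.

Lemma cvg_rnorm (u : nat -> H) (l : H) :
  u @ \oo --> l -> (fun n => rnorm (u n)) @ \oo --> rnorm l.
Proof.
move=> /cvgrPdist_lt ul; apply/cvgrPdist_lt => e e0.
have e0' : 0 < e%:C by rewrite ltcR.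
apply: filterS (ul _ e0') => n; rewrite normE ltcR; apply: le_lt_trans.
by rewrite ler_norml rnormB -lerN2 opprK opprB rnormBC rnormB.
Qed.

Lemma cvg_rdot (u : nat -> H) (l x : H) :
  u @ \oo --> l -> (fun n => rdot (u n) x) @ \oo --> rdot l x.
Proof.
move=> /cvg_rnormP ul; apply/cvgrPdist_le => e e0.
move/cvgrPdist_lt: ul => /(_ (e / (rnorm x + 1))) h.
(* Adding 1 avoids a separate case for x = 0. *)
have x1 : 0 < rnorm x + 1 by rewrite ltr_wpDl ?rnorm_ge0.
have {}h := h (divr_gt0 e0 x1); apply: filterS h => n.
rewrite sub0r normrN ger0_norm ?rnorm_ge0 // => h.
rewrite -rdotNl -rdotDl; apply: le_trans (rdot_le _ _) _.
apply: (@le_trans _ _ (e / (rnorm x + 1) * rnorm x)).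
  by rewrite ler_wpM2r ?rnorm_ge0 // ltW.
rewrite -mulrA ler_piMr ?(ltW e0) // mulrC ler_pdivrMr //; lra.
Qed.

Lemma cvg_bounded (T : {linear H -> H}) (u : nat -> H) (l : H) :
  bounded_operator T -> u @ \oo --> l -> (fun n => T (u n)) @ \oo --> T l.
Proof.
move=> [M hM] /cvg_rnormP ul; apply/cvg_rnormP.
apply: (@squeeze_cvgr _ _ _ _ (fun=> 0) (fun n => M * rnorm (l - u n))).
- by apply: nearW => n; rewrite rnorm_ge0 -linearB hM.
- exact: cvg_cst.
- by rewrite -[X in _ --> X](mulr0 M); apply: cvgM => //; apply: cvg_cst.
Qed.

Lemma closed_seq (A : set H) (u : nat -> H) l :
  closed A -> (forall n, A (u n)) -> u @ \oo --> l -> A l.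
Proof. by move=> cA hu; apply: (closed_cvg A cA (nearW _ hu)). Qed.

Lemma closedP (A : set H) :
  (forall (u : nat -> H) l, (forall n, A (u n)) -> u @ \oo --> l -> A l) ->
  closed A.
Proof.
move=> hA l cl.
have h (n : nat) : exists y, A y /\ rnorm (l - y) < n.+1%:R^-1.
  have e0 : (0 : R[i]) < (n.+1%:R^-1 : R)%:C by rewrite ltcR invr_gt0 ltr0n.
  have [y [Ay]] := cl _ (nbhsx_ballx l _ e0).
  by rewrite -ball_normE /= normE ltcR => ?; exists y.
have [u hu] := choice h.
apply: (hA u) => [n|]; first by case: (hu n).
apply/cvg_rnormP.
apply: (@squeeze_cvgr _ _ _ _ (fun=> 0) (fun n => n.+1%:R^-1)).
- by apply: nearW => n; rewrite rnorm_ge0 ltW //; case: (hu n).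
- exact: cvg_cst.
- exact: cvg_harmonic.
Qed.

Lemma cvg_eq_unique (K : numFieldType) (V : normedModType K)
    (u v : nat -> V) (k l : V) :
  u =1 v -> u @ \oo --> k -> v @ \oo --> l -> k = l.
Proof. by move=> /funext ->; apply: cvg_unique. Qed.

Lemma closed_ker (T : {linear H -> H}) : bounded_operator T -> closed (ker T).
Proof.
move=> Tb; apply: closedP => u l /= hu ul.
exact: (cvg_eq_unique hu (cvg_bounded Tb ul) (cvg_cst _)).
Qed.

(** [cvg_rdot] passes to the limit in real parts only, so it is applied to all multiples
    [a *: u n]. *)
Lemma closed_dot0 x : closed [set y | dot y x = 0].
Proof.
apply: closedP => u l /= hu ul; apply: rdotZ_eq0 => a.
have h : (fun n => rdot (a *: u n) x) @ \oo --> rdot (a *: l) x.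
  by apply: cvg_rdot; apply: cvgZl_tmp.
apply: (cvg_eq_unique _ h (cvg_cst _)) => n.
by rewrite /rdot dotZl hu mulr0.
Qed.

End InnerProduct.

(** * Subspaces, projections and adjoints *)

Section Projection.
Variables (R : realType) (H : completeNormedModType R[i]).
Variable (dot : {dot H for @Num.conj R[i]}).
Hypothesis dotE : norm_induced_by dot.
Implicit Types (x y z : H) (a : R[i]) (r : R).

Local Notation rdot := (re_dot dot).
Local Notation rdotE := (rdotE dot).

Definition subspace (E : set H) :=
  E 0 /\ forall a x y, E x -> E y -> E (a *: x + y).

Lemma subspaceD E x y : subspace E -> E x -> E y -> E (x + y).
Proof. by move=> [_ h] Ex Ey; rewrite -[x]scale1r; apply: h. Qed.

Lemma subspaceZ E a x : subspace E -> E x -> E (a *: x).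
Proof. by move=> [h0 h] Ex; rewrite -[_ *: _]addr0; apply: h. Qed.

Lemma subspaceB E x y : subspace E -> E x -> E y -> E (x - y).
Proof.
by move=> hE Ex Ey; rewrite -scaleN1r; apply: subspaceD => //; apply: subspaceZ.
Qed.

Lemma subspace_ker (T : {linear H -> H}) : subspace (ker T).
Proof.
split=> [|a x y]; rewrite /ker /= ?linear0 // => Tx Ty.
by rewrite linearP Tx Ty scaler0 addr0.
Qed.

Lemma ex_linear (f : H -> H) : linear f -> exists g : {linear H -> H}, g =1 f.
Proof.
move=> lf; pose F := GRing.isLinear.Build R[i] H H *:%R f lf.
pose g : {linear H -> H} := HB.pack f F.
by exists g.
Qed.

(** A minimizing sequence is Cauchy by the parallelogram law, because the midpoint of two of its
    terms lies in [E] again. *)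
Lemma closest_point (E : set H) x : subspace E -> closed E ->
  exists2 p, E p & forall y, E y -> rnorm (x - p) <= rnorm (x - y).
Proof.
move=> sE cE.
pose A := [set rnorm (x - y) ^+ 2 | y in E].
have iA : has_inf A.
  split; first by exists (rnorm (x - 0) ^+ 2), 0 => //; exact: sE.1.
  by exists 0 => _ [y _ <-]; rewrite sqr_ge0.
have h (n : nat) : exists y, E y /\ rnorm (x - y) ^+ 2 < inf A + n.+1%:R^-1.
  have n0 : 0 < n.+1%:R^-1 :> R by rewrite invr_gt0 ltr0n.
  by have [_ [y Ey <-] yA] := inf_adherent n0 iA; exists y.
have [u hu] := choice h.
have infA y : E y -> inf A <= rnorm (x - y) ^+ 2.
  by move=> Ey; apply: ge_inf; [exact: iA.2 | exists y].
have [p up] : exists l : H, u @ \oo --> l.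
  apply: rnorm_complete => e e0.
  (* The parallelogram law bounds the square of ‖u n - u N‖ by 2/(n+1) + 2/(N+1), hence by 4/(N+1)
     for n >= N. *)
  have [N hN] : exists N, N.+1%:R^-1 < e ^+ 2 / 4.
    have /cvgrPdist_lt := @cvg_harmonic R.
    move=> /(_ (e ^+ 2 / 4)) [|N _ hN]; first by rewrite divr_gt0 // exprn_gt0.
    exists N; have := hN N (leqnn _).
    by rewrite /= sub0r normrN ger0_norm // invr_ge0.
  exists N => n Nn; rewrite -(ltr_pXn2r (n := 2)) // ?nnegrE ?rnorm_ge0 ?ltW //.
  have [En hn] := hu n; have [EN hN'] := hu N.
  have mid : E ((2^-1 : R)%:C *: (u n + u N)).
    by apply: subspaceZ => //; apply: subspaceD.
  have := infA _ mid; set w := x - _.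
  have -> : u n - u N = (x - u N) - (x - u n) by rewrite [RHS]addrC opprB subrKA.
  have e1 : rnorm (x - u N - (x - u n)) ^+ 2 + 4 * rnorm w ^+ 2 =
            2 * (rnorm (x - u N) ^+ 2 + rnorm (x - u n) ^+ 2).
    have -> : 4 * rnorm w ^+ 2 = rnorm ((x - u N) + (x - u n)) ^+ 2.
      have -> : (x - u N) + (x - u n) = (2 : R)%:C *: w.
        rewrite /w scalerBr scalerA -rmorphM divff ?pnatr_eq0 //.
        rewrite rmorph1 scale1r addrACA -opprD.
        by rewrite [u N + _]addrC rmorphMn /= scaler_nat mulr2n.
      by rewrite rnormZr exprMn ger0_norm //; congr (_ * _); ring.
    rewrite (rnorm_sqrB dotE (x - u N)) (rnorm_sqrD dotE (x - u N) (x - u n)).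
    by ring.
  have : n.+1%:R^-1 <= N.+1%:R^-1 :> R.
    by rewrite lef_pV2 ?posrE ?ltr0n // ler_nat.
  move: hN hn hN' e1.
  move: (n.+1%:R^-1) (N.+1%:R^-1) (inf A) => s t i.
  move: (rnorm (x - u n)) (rnorm (x - u N)) (rnorm w) (rnorm _) => r1 r2 r3 r4.
  lra.
have Ep : E p by apply: (closed_seq cE _ up) => n; case: (hu n).
exists p => // y Ey.
rewrite -(ler_pXn2r (n := 2)) // ?nnegrE ?rnorm_ge0 //.
apply: le_trans (infA _ Ey).
have ux : (fun n => rnorm (x - u n) ^+ 2) @ \oo --> rnorm (x - p) ^+ 2.
  have h1 : (fun n => rnorm (x - u n)) @ \oo --> rnorm (x - p).
    by apply: cvg_rnorm; apply: cvgB => //; apply: cvg_cst.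
  by rewrite expr2; under eq_fun do rewrite expr2; apply: cvgM.
have h2 : (fun n => inf A + n.+1%:R^-1) @ \oo --> inf A.
  rewrite -[X in _ --> X]addr0; apply: cvgD; first exact: cvg_cst.
  exact: cvg_harmonic.
apply: (ler_cvg_to ux h2); apply: nearW => n.
by apply: ltW; case: (hu n).
Qed.

(** Minimality of the distance along the lines p + t y forces orthogonality of the residual.
    Linearity follows from uniqueness: the defect of additivity and homogeneity lies in [E] and is
    also orthogonal to [E]. *)
Lemma projection_exists (E : set H) : subspace E -> closed E ->
  exists P : {linear H -> H}, forall x, E (P x) /\
    forall y, E y -> dot y (x - P x) = 0.
Proof.
move=> sE cE.
have h x : exists p, E p /\ forall y, E y -> dot y (x - p) = 0.
  have [p Ep hp] := closest_point x sE cE.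
  exists p; split=> // y0 Ey0; apply: rdotZ_eq0 => a.
  have := subspaceZ a sE Ey0; move: (a *: y0) => y Ey.
  have q (t : R) : 0 <= t ^+ 2 * rnorm y ^+ 2 - 2 * (t * rdot y (x - p)).
    have /hp : E (p + t%:C *: y) by apply: subspaceD => //; apply: subspaceZ.
    rewrite -(ler_pXn2r (n := 2)) // ?nnegrE ?rnorm_ge0 // opprD addrA.
    rewrite (rnorm_sqrB dotE (x - p)) rdotZr rnormZr exprMn real_normK ?num_real //.
    by rewrite -subr_ge0 (rdotC _ (x - p)); congr (0 <= _); ring.
  have [y_0|y_0] := eqVneq y 0; first by rewrite y_0 rdot0l.
  have yn : 0 < rnorm y ^+ 2 by rewrite exprn_gt0 // rnorm_gt0.
  (* This t minimizes the quadratic polynomial of [q]. *)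
  have := q (rdot y (x - p) / rnorm y ^+ 2); set s := rdot _ _ => hs.
  have e : (s / rnorm y ^+ 2) ^+ 2 * rnorm y ^+ 2 - 2 * (s / rnorm y ^+ 2 * s)
     = - (s ^+ 2 / rnorm y ^+ 2) by field; apply: lt0r_neq0; rewrite rnorm_gt0.
  move: hs; rewrite e oppr_ge0 pmulr_lle0 ?invr_gt0 // => s0.
  by apply/eqP; rewrite -sqrf_eq0; apply/eqP/le_anti; rewrite s0 sqr_ge0.
have [f hf] := choice h.
have lf : linear f.
  move=> a x y; apply/eqP; rewrite -subr_eq0; apply/eqP.
  have [fx ox] := hf x; have [fy oy] := hf y; have [fz oz] := hf (a *: x + y).
  set d := _ - _; have Ed : E d by apply: subspaceB => //; apply: sE.2.
  apply: (dot_self0 dotE).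
  have -> : dot d d = dot d ((a *: (x - f x) + (y - f y)) -
     ((a *: x + y) - f (a *: x + y))).
    by congr (dot d _); rewrite scalerBr addrACA -opprD [RHS]addrC opprB subrKA.
  by rewrite dotBr dotDr dotZr ox // oy // oz // mulr0 addr0 subr0.
have [P hP] := ex_linear lf.
by exists P => x; rewrite hP; exact: hf.
Qed.

Lemma bounded_operator_ge0 (T : H -> H) : bounded_operator T ->
  exists2 M : R, 0 <= M & forall x, rnorm (T x) <= M * rnorm x.
Proof.
move=> [M hM]; exists `|M| => // x; apply: le_trans (hM x) _.
by rewrite ler_wpM2r ?rnorm_ge0 // ler_norm.
Qed.

(** This is Riesz' theorem for the functional x -> <Tx, y>: unless it vanishes, a vector [v]
    orthogonal to its closed kernel, suitably scaled, represents it. *)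
Lemma adjoint_exists (T : {linear H -> H}) : bounded_operator T ->
  exists T' : {linear H -> H}, bounded_operator T' /\
    forall x y, dot (T x) y = dot x (T' y).
Proof.
move=> Tb.
have h y : exists z, forall x, dot (T x) y = dot x z.
  pose E := [set x | dot (T x) y = 0].
  have sE : subspace E.
    split=> [|a u v]; rewrite /E /= ?linear0 ?dot0l // => u0 v0.
    by rewrite linearP dotDl dotZl u0 v0 mulr0 addr0.
  have cE : closed E.
    apply: closedP => u l hu ul.
    have cl := @closed_dot0 _ _ _ dotE y.
    exact: (@closed_seq _ _ _ (fun n => T (u n)) (T l) cl hu (cvg_bounded Tb ul)).
  have [P hP] := projection_exists sE cE.
  have [hE|/existsNP[w hw]] := pselect (forall x, E x).
    by exists 0 => x; rewrite dot0r hE.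
  pose v := w - P w.
  have Tv : dot (T v) y != 0.
    by rewrite /v linearB dotBl (hP w).1 subr0; apply/eqP.
  have v0 : dot v v != 0.
    by apply: contra_neq Tv => /(dot_self0 dotE) ->; rewrite linear0 dot0l.
  exists ((dot (T v) y / dot v v)^*%C *: v) => x.
  (* With this coefficient x - c v lies in the kernel [E], so <x, v> = c <v, v>. *)
  pose c := dot (T x) y / dot (T v) y.
  have Ex : E (x - c *: v).
    by rewrite /E /= linearB linearZ dotBl dotZl divfK // subrr.
  have : dot (x - c *: v) v = 0 by exact: (hP w).2.
  rewrite dotBl dotZl => /eqP; rewrite subr_eq0 dotZr conjcK => /eqP ->.
  by rewrite /c; field; rewrite Tv v0.
have [f hf] := choice h.
have lf : linear f.
  move=> a x y; apply: (rdot_eq dotE) => z.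
  by rewrite /re_dot -hf !dotDr !dotZr !hf.
have [T' hT'] := ex_linear lf.
exists T'; split=> [|x y]; last by rewrite hT' hf.
have [M M0 hM] := bounded_operator_ge0 Tb.
exists M => y; have [->|y0] := eqVneq (T' y) 0.
  by rewrite rnorm0 mulr_ge0 ?rnorm_ge0.
have n0 : 0 < rnorm (T' y) by rewrite rnorm_gt0.
(* A bound of T is also one of T', since ‖T'y‖^2 = <T T'y, y> <= M ‖T'y‖ ‖y‖. *)
rewrite -(ler_pM2l n0) -expr2 -(rdotxx dotE) [rdot _ _]/re_dot {2}hT' -hf.
apply: le_trans (ler_norm _) _; apply: le_trans (rdot_le dotE _ _) _.
by rewrite mulrCA mulrA ler_wpM2r ?rnorm_ge0.
Qed.

(** By polarization the quadratic form bounds <Ax, y>; choosing for y the multiple of A x that has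
    the norm of x yields ‖Ax‖. *)
Lemma symmetric_norm_le (A : {linear H -> H}) r :
  (forall x y, rdot (A x) y = rdot x (A y)) ->
  (forall x, `|rdot (A x) x| <= r * rnorm x ^+ 2) ->
  forall x, rnorm (A x) <= r * rnorm x.
Proof.
move=> sA hA x.
have polar y :
    4 * rdot (A x) y = rdot (A (x + y)) (x + y) - rdot (A (x - y)) (x - y).
  by rewrite !linearB !linearD !rdotE (sA y x) (rdotC dot y (A x)); ring.
have [->|x0] := eqVneq x 0; first by rewrite linear0 rnorm0 mulr0.
have [->|Ax0] := eqVneq (A x) 0.
  have := le_trans (normr_ge0 _) (hA x).
  by rewrite rnorm0 expr2 mulrA pmulr_lge0 // rnorm_gt0.
pose t := rnorm x / rnorm (A x); pose y := t%:C *: A x.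
have nx : 0 < rnorm x by rewrite rnorm_gt0.
have nA : 0 < rnorm (A x) by rewrite rnorm_gt0.
have ny : rnorm y = rnorm x.
  by rewrite /y rnormZr ger0_norm ?divr_ge0 ?ltW // divfK // gt_eqF.
have := hA (x + y); have := hA (x - y).
rewrite (rnorm_sqrB dotE) (rnorm_sqrD dotE) ny !ler_norml.
move=> /andP[h1 _] /andP[_ h2].
have : 4 * rdot (A x) y <= 4 * (r * rnorm x ^+ 2) by rewrite polar; lra.
rewrite ler_pM2l // /y rdotZr (rdotxx dotE) /t.
have -> : rnorm x / rnorm (A x) * rnorm (A x) ^+ 2 = rnorm x * rnorm (A x).
  by field; rewrite gt_eqF.
by rewrite expr2 mulrCA ler_pM2l.
Qed.

End Projection.

(** * Square roots of positive operators *)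

Section SquareRoot.
Variables (R : realType) (H : completeNormedModType R[i]).
Variable (dot : {dot H for @Num.conj R[i]}).
Hypothesis dotE : norm_induced_by dot.
Implicit Types (x y z : H) (a : R[i]) (r : R).

Local Notation rdot := (re_dot dot).
Local Notation rdotE := (rdotE dot).

Lemma pointwise_limit_linear (Y : nat -> H -> H) :
  (forall n, linear (Y n)) -> (forall x, exists l : H, Y^~ x @ \oo --> l) ->
  exists L : {linear H -> H}, forall x, Y^~ x @ \oo --> L x.
Proof.
move=> lY cY; have [f hf] := choice cY.
have lf : linear f.
  move=> a x y.
  have h : (fun n => a *: Y n x + Y n y) @ \oo --> a *: f x + f y.
    by apply: cvgD => //; apply: cvgZl_tmp.
  by apply: (cvg_eq_unique _ (hf _) h) => n; rewrite lY.
by have [L hL] := ex_linear lf; exists L => x; rewrite hL.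
Qed.

Lemma cvg_rnorm_le (u : nat -> H) l r :
  u @ \oo --> l -> (forall n, rnorm (u n) <= r) -> rnorm l <= r.
Proof.
move=> /cvg_rnorm ul ur; apply: (ler_cvg_to ul (cvg_cst r)).
exact: nearW.
Qed.

(* The limit Y satisfies Y = (A + Y^2) / 2, that is, (1 - Y)^2 = 1 - A. *)
Fixpoint sqrt_iter (A : H -> H) (n : nat) : H -> H :=
  if n is n'.+1 then
    fun x => (2^-1 : R)%:C *: (A x + sqrt_iter A n' (sqrt_iter A n' x))
  else fun=> 0.

(** The same recursion with a scalar in place of A. It majorizes the norms of the iterates and of
    their differences; for r = 1 - mu^2 it has the fixed point 1 - mu. *)
Fixpoint sqrt_iter_bound r (n : nat) : R :=
  if n is n'.+1 then (r + sqrt_iter_bound r n' ^+ 2) / 2 else 0.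

(** * Convergence of the square root iteration *)

Section Iteration.
Variables (A : {linear H -> H}) (mu : R).
Hypotheses (mu01 : 0 <= mu <= 1) (sA : forall x y, rdot (A x) y = rdot x (A y)).
Hypothesis hA : forall x, rnorm (A x) <= (1 - mu ^+ 2) * rnorm x.

Local Notation Y := (sqrt_iter A).
Local Notation y := (sqrt_iter_bound (1 - mu ^+ 2)).

Lemma sqrt_iter_linear n : linear (Y n).
Proof.
elim: n => [|n ih] a u v /=; first by rewrite scaler0 addr0.
rewrite linearP !ih scalerA mulrC -scalerA -scalerDr; congr (_ *: _).
by rewrite scalerDr addrACA.
Qed.

Lemma sqrt_iter_symmetric n u v : rdot (Y n u) v = rdot u (Y n v).
Proof.
elim: n u v => [|n ih] u v /=; first by rewrite rdot0l rdot0r.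
by rewrite !rdotE sA !ih.
Qed.

Lemma sqrt_iter_commute (C : {linear H -> H}) n :
  (forall x, C (A x) = A (C x)) -> forall x, C (Y n x) = Y n (C x).
Proof.
move=> CA; elim: n => [|n ih] x /=; first by rewrite linear0.
by rewrite linearZ /= linearD CA !ih.
Qed.

Lemma sqrt_iter_bound_ge0 n : 0 <= y n.
Proof.
have : 0 <= 1 - mu ^+ 2.
  by case/andP: mu01 => m0 m1; rewrite subr_ge0 expr_le1.
by case: n => //= n h; rewrite divr_ge0 // addr_ge0 // sqr_ge0.
Qed.

Lemma sqrt_iter_bound_le n : y n <= 1 - mu.
Proof.
case/andP: mu01 => m0 m1; elim: n => [|n ih] /=; first by rewrite subr_ge0.
have := sqrt_iter_bound_ge0 n; nra.
Qed.

Lemma sqrt_iter_bound_homo : {homo y : m n / (m <= n)%N >-> m <= n}.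
Proof.
apply: homo_leq => [//|s t u|n]; first exact: le_trans.
elim: n => [|n ih]; first by exact: (sqrt_iter_bound_ge0 1).
rewrite -[leLHS]/((1 - mu ^+ 2 + y n ^+ 2) / 2).
rewrite -[leRHS]/((1 - mu ^+ 2 + y n.+1 ^+ 2) / 2).
have := sqrt_iter_bound_ge0 n; have := sqrt_iter_bound_ge0 n.+1; move: ih.
move: (y n.+1) (y n) => s t st s0 t0.
rewrite ler_pM2r ?invr_gt0 // lerD2l.
by rewrite ler_pXn2r ?nnegrE.
Qed.

Lemma sqrt_iter_le n x : rnorm (Y n x) <= y n * rnorm x.
Proof.
elim: n x => [|n ih] x /=; first by rewrite rnorm0 mul0r.
rewrite rnormZr ger0_norm ?invr_ge0 // mulrC mulrAC ler_pM2r ?invr_gt0 //.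
apply: le_trans (rnormD _ _) _; rewrite mulrDl lerD ?hA //.
apply: le_trans (ih _) _; rewrite expr2 -mulrA.
by rewrite ler_wpM2l // sqrt_iter_bound_ge0.
Qed.

(** Both recursions difference by the identity Y^2 - Z^2 = Y(Y - Z) + (Y - Z)Z, so operator
    increments are dominated by scalar ones. *)
Lemma sqrt_iter_diff n x : rnorm (Y n.+1 x - Y n x) <= (y n.+1 - y n) * rnorm x.
Proof.
elim: n x => [|n ih] x.
  by have := sqrt_iter_le 1 x; rewrite /= !subr0.
have -> : y n.+2 - y n.+1 = (y n.+1 * (y n.+1 - y n) + (y n.+1 - y n) * y n) / 2.
  by rewrite /=; field.
have -> : Y n.+2 x - Y n.+1 x = (2^-1 : R)%:C *:
    (Y n.+1 (Y n.+1 x - Y n x) + (Y n.+1 (Y n x) - Y n (Y n x))).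
  have [L hL] := ex_linear (sqrt_iter_linear n.+1).
  rewrite -[LHS]/((2^-1 : R)%:C *: (A x + Y n.+1 (Y n.+1 x)) -
    (2^-1 : R)%:C *: (A x + Y n (Y n x))).
  by rewrite -scalerBr opprD addrACA subrr add0r -!hL (linearB L) subrKA.
rewrite rnormZr ger0_norm ?invr_ge0 // mulrC mulrAC ler_pM2r ?invr_gt0 //.
apply: le_trans (rnormD _ _) _; rewrite mulrDl lerD //.
  apply: le_trans (sqrt_iter_le _ _) _; rewrite -[leRHS]mulrA.
  by apply: ler_wpM2l => //; apply: sqrt_iter_bound_ge0.
apply: le_trans (ih _) _; rewrite -[leRHS]mulrA ler_wpM2l ?sqrt_iter_le //.
by rewrite subr_ge0 sqrt_iter_bound_homo.
Qed.

Lemma sqrt_iter_dist m n x :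
  (m <= n)%N -> rnorm (Y n x - Y m x) <= (y n - y m) * rnorm x.
Proof.
move=> /subnK <-; elim: (n - m)%N => [|k ih]; first by rewrite !subrr rnorm0 mul0r.
rewrite addSn -(subrKA (Y (k + m) x)).
apply: le_trans (rnormD _ _) _; have := sqrt_iter_diff (k + m) x; lra.
Qed.

Lemma sqrt_iter_cvg : exists L : {linear H -> H}, forall x, Y^~ x @ \oo --> L x.
Proof.
apply: pointwise_limit_linear => [|x]; first exact: sqrt_iter_linear.
apply: rnorm_complete => e e0.
have d0 : 0 < e / (rnorm x + 1) by rewrite divr_gt0 // ltr_wpDl ?rnorm_ge0.
have [N hN] := bounded_monotone_cauchy sqrt_iter_bound_homo sqrt_iter_bound_le d0.
exists N => n Nn; apply: le_lt_trans (sqrt_iter_dist x Nn) _.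
have := hN n Nn; rewrite ltr_pdivlMr ?ltr_wpDl ?rnorm_ge0 // mulrDr mulr1.
apply: le_lt_trans; rewrite lerDl subr_ge0; exact: sqrt_iter_bound_homo.
Qed.

End Iteration.

(** The iteration is run on A = 1 - B, whose norm is at most 1 - mu^2; its limit L satisfies 2L = A
    + L^2, and P = 1 - L. The third clause encodes P >= mu, and for mu = 0 just P >= 0. The
    commutation clause holds for the iterates by induction and passes to the limit. *)
Lemma sqrt_exists (B : {linear H -> H}) mu : 0 <= mu <= 1 ->
  (forall x y, rdot (B x) y = rdot x (B y)) ->
  (forall x, mu ^+ 2 * rnorm x ^+ 2 <= rdot (B x) x <= rnorm x ^+ 2) ->
  exists P : {linear H -> H}, [/\ forall x, P (P x) = B x,
    forall x y, rdot (P x) y = rdot x (P y),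
    forall x, rnorm (x - P x) <= (1 - mu) * rnorm x &
    forall C : {linear H -> H}, bounded_operator C ->
      (forall x, C (B x) = B (C x)) -> forall x, C (P x) = P (C x)].
Proof.
move=> mu01 sB hB.
have lA : linear (fun x => x - B x).
  by move=> a x y; rewrite linearP scalerBr opprD addrACA.
have [A AE] := ex_linear lA.
have sA x y : rdot (A x) y = rdot x (A y) by rewrite !AE !rdotE sB.
have hA : forall x, rnorm (A x) <= (1 - mu ^+ 2) * rnorm x.
  apply: (symmetric_norm_le dotE) => // x.
  rewrite AE !rdotE (rdotxx dotE); have /andP[h1 h2] := hB x.
  by rewrite ger0_norm ?subr_ge0 //; lra.
have [L hL] := sqrt_iter_cvg mu01 hA.
have Lle x : rnorm (L x) <= (1 - mu) * rnorm x.
  apply: (cvg_rnorm_le (hL x)) => n; apply: le_trans (sqrt_iter_le mu01 hA n x) _.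
  by rewrite ler_wpM2r ?rnorm_ge0 // sqrt_iter_bound_le.
(* Pointwise convergence passes to the squares because every iterate is a contraction. *)
have LL x : (fun n => sqrt_iter A n (sqrt_iter A n x)) @ \oo --> L (L x).
  apply/cvg_rnormP.
  apply: (@squeeze_cvgr _ _ _ _ (fun=> 0)
    (fun n => rnorm (L (L x) - sqrt_iter A n (L x)) +
              rnorm (L x - sqrt_iter A n x))).
  - apply: nearW => n; rewrite rnorm_ge0 /=.
    rewrite -(subrKA (sqrt_iter A n (L x))); apply: le_trans (rnormD _ _) _.
    rewrite lerD2l; have [K hK] := ex_linear (sqrt_iter_linear A n).
    rewrite -!hK -linearB !hK; apply: le_trans (sqrt_iter_le mu01 hA n _) _.
    rewrite ler_piMl ?rnorm_ge0 //; apply: le_trans (sqrt_iter_bound_le mu01 n) _.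
    by case/andP: mu01 => ? _; rewrite gerDl oppr_le0.
  - exact: cvg_cst.
  - by rewrite -[X in _ --> X]addr0; apply: cvgD; apply/cvg_rnormP; apply: hL.
have LE x : (2 : R)%:C *: L x = A x + L (L x).
  have h : (fun n => sqrt_iter A n.+1 x) @ \oo --> L x.
    by rewrite (cvg_shiftS (sqrt_iter A ^~ x)); apply: hL.
  have h2 : (fun n => sqrt_iter A n.+1 x) @ \oo -->
      (2^-1 : R)%:C *: (A x + L (L x)).
    by apply: cvgZl_tmp; apply: cvgD => //; apply: cvg_cst.
  rewrite [in LHS](cvg_unique _ h h2) // scalerA -rmorphM divff ?pnatr_eq0 //.
  by rewrite rmorph1 scale1r.
have lP : linear (fun x => x - L x).
  by move=> a x y; rewrite linearP scalerBr opprD addrACA.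
have [P PE] := ex_linear lP.
exists P; split=> [x|x y|x|C Cb CB x].
- rewrite !PE linearB -[B x](subKr x) -AE.
  have -> : A x = (2 : R)%:C *: L x - L (L x) by rewrite LE addrK.
  by rewrite rmorphMn scaler_nat mulr2n -[LHS]addrA -opprD addrA.
- rewrite !PE !rdotE; congr (_ - _).
  have h1 := cvg_rdot dotE (hL x) (x := y).
  have h2 := cvg_rdot dotE (hL y) (x := x).
  rewrite [RHS]rdotC; apply: (cvg_eq_unique _ h1 h2) => n.
  by rewrite (sqrt_iter_symmetric sA) rdotC.
- by rewrite PE subKr Lle.
- rewrite !PE linearB; congr (_ - _).
  have h1 := cvg_bounded Cb (hL x).
  apply: (cvg_eq_unique _ h1 (hL _)) => n; apply: sqrt_iter_commute => z.
  by rewrite !AE linearB CB.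
Qed.

End SquareRoot.

(** * Polar decomposition and spectral subspaces *)

Section Polar.
Variables (R : realType) (H : completeNormedModType R[i]).
Variable (dot : {dot H for @Num.conj R[i]}).
Hypothesis dotE : norm_induced_by dot.
Implicit Types (x y z : H) (a : R[i]) (r : R).

Local Notation rdot := (re_dot dot).
Local Notation rdotE := (rdotE dot).

(** Preimages chosen in [K] of a convergent sequence of the range are Cauchy by the lower bound. *)
Lemma closed_range (T : {linear H -> H}) (K : set H) b : bounded_operator T ->
  subspace K -> 0 < b -> (forall x, K x -> b * rnorm x <= rnorm (T x)) ->
  (forall x, exists2 k, K k & T k = T x) -> closed (range T).
Proof.
move=> Tb sK b0 hK hT; apply: closedP => u l hu ul.
have h n : exists k, K k /\ T k = u n.
  by have [x _ <-] := hu n; have [k Kk Tk] := hT x; exists k.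
have [k hk] := choice h.
have [p kp] : exists p : H, k @ \oo --> p.
  apply: rnorm_complete => e e0.
  have /cvgrPdist_lt := (cvg_rnormP u l).1 ul.
  move=> /(_ (b * e / 2)) [|N _ hN]; first by rewrite divr_gt0 // mulr_gt0.
  exists N => n Nn; rewrite -(ltr_pM2l b0).
  have [Kn Tn] := hk n; have [KN TN] := hk N.
  apply: le_lt_trans (hK _ (subspaceB sK Kn KN)) _.
  rewrite linearB Tn TN -(subrKA l); apply: le_lt_trans (rnormD _ _) _.
  have := hN n Nn; have := hN N (leqnn _); rewrite /= !sub0r !normrN.
  rewrite !ger0_norm ?rnorm_ge0 // (rnormBC (u n)).
  move: (rnorm _) (rnorm _) => s t; lra.
exists p => //; apply: (cvg_eq_unique _ (cvg_bounded Tb kp) ul) => n.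
by case: (hk n).
Qed.

Lemma rdot_adjoint (T T' : {linear H -> H}) :
  (forall x y, dot (T x) y = dot x (T' y)) ->
  forall x y, rdot (T' (T x)) y = rdot (T x) (T y).
Proof. by move=> h x y; rewrite rdotC /re_dot -h -/(re_dot _ _ _) rdotC. Qed.

Lemma linear_of_injective (P : {linear H -> H}) (g : H -> H) :
  (forall x, P x = 0 -> x = 0) -> (forall y, P (g y) = y) -> linear g.
Proof.
move=> P0 Pg a x y; apply/eqP; rewrite -subr_eq0; apply/eqP/P0.
by rewrite linearB linearP !Pg subrr.
Qed.

(** The range is closed by the lower bound, and by symmetry a vector orthogonal to it lies in the
    kernel, which is zero. *)
Lemma symmetric_surjective (P : {linear H -> H}) b : bounded_operator P ->
  (forall x y, rdot (P x) y = rdot x (P y)) -> 0 < b ->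
  (forall x, b * rnorm x <= rnorm (P x)) -> forall y, exists x, P x = y.
Proof.
move=> Pb sP b0 hP y.
have P0 x : P x = 0 -> x = 0.
  move=> Px; apply/eqP; have := hP x; rewrite Px rnorm0 pmulr_rle0 //.
  by rewrite -rnorm_eq0 => h; apply/eqP/le_anti; rewrite h rnorm_ge0.
have cR : closed (range P).
  apply: (@closed_range P setT b) => //.
  by move=> x; exists x.
have sR : subspace (range P).
  split; first by exists 0; rewrite ?linear0.
  by move=> a _ _ [x _ <-] [z _ <-]; exists (a *: x + z); rewrite ?linearP.
have [Q hQ] := projection_exists dotE sR cR.
have [[x _ Px] ort] := hQ y; exists x; rewrite Px.
apply/esym/eqP; rewrite -subr_eq0; apply/eqP/P0/(rdot_eq dotE) => z.
rewrite -sP rdot0r; apply: dot0_rdot; apply: ort.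
by exists z.
Qed.

(** Let P be the square root of S*S / M^2 and V = S P^-1 / M. Then V is an isometry and S - cV =
    V(MP - c), where b <= MP <= M; the midpoint c = (M + b)/2 gives the bound (M - b)/2. *)
Lemma isometry_near (S : {linear H -> H}) (b M : R) : 0 < b -> b <= M ->
  (forall x, b * rnorm x <= rnorm (S x) <= M * rnorm x) ->
  exists V : {linear H -> H}, (forall x, rnorm (V x) = rnorm x) /\
   forall x, rnorm (S x - ((M + b) / 2)%:C *: V x) <= (M - b) / 2 * rnorm x.
Proof.
move=> b0 bM hS; have M0 : 0 < M := lt_le_trans b0 bM.
have Sb : bounded_operator S by exists M => x; case/andP: (hS x).
have [S' [S'b hS']] := adjoint_exists dotE Sb.
have lB : linear (fun x => (M ^- 2)%:C *: S' (S x)).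
  by move=> a x y; rewrite !linearP.
have [B BE] := ex_linear lB.
have BS x y : rdot (B x) y = M ^- 2 * rdot (S x) (S y).
  by rewrite BE rdotZl (rdot_adjoint hS').
have sB x y : rdot (B x) y = rdot x (B y).
  by rewrite [RHS]rdotC !BS rdotC.
have mu01 : 0 <= b / M <= 1.
  by rewrite divr_ge0 ?(ltW b0) ?(ltW M0) //= ler_pdivrMr // mul1r.
have hB x : (b / M) ^+ 2 * rnorm x ^+ 2 <= rdot (B x) x <= rnorm x ^+ 2.
  rewrite BS (rdotxx dotE); have /andP[h1 h2] := hS x.
  have M2 : 0 < M ^+ 2 by rewrite exprn_gt0.
  rewrite expr_div_n mulrAC mulrC ler_pM2l ?invr_gt0 // -exprMn.
  rewrite ler_pXn2r ?nnegrE ?mulr_ge0 ?rnorm_ge0 ?(ltW b0) // h1 /=.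
  rewrite mulrC ler_pdivrMr // mulrC -exprMn.
  by rewrite ler_pXn2r ?nnegrE ?mulr_ge0 ?rnorm_ge0 ?(ltW M0).
have [P [PP sP Pmu _]] := sqrt_exists dotE mu01 sB hB.
have PS x : M * rnorm (P x) = rnorm (S x).
  apply/eqP; rewrite -(eqrXn2 (n := 2)) ?mulr_ge0 ?rnorm_ge0 ?(ltW M0) //.
  rewrite exprMn -(rdotxx dotE) -sP PP BS (rdotxx dotE) mulrA divff ?mul1r //.
  by rewrite expf_neq0 // gt_eqF.
have P1 x : rnorm (P x) <= rnorm x.
  by have /andP[_] := hS x; rewrite -PS ler_pM2l.
have Pb : bounded_operator P by exists 1 => x; rewrite mul1r.
have bP x : b / M * rnorm x <= rnorm (P x).
  have /andP[h _] := hS x; move: h; rewrite -PS [M * _]mulrC.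
  by rewrite -ler_pdivrMr // mulrAC.
have P0 x : P x = 0 -> x = 0.
  move=> Px; apply/eqP; have := bP x; rewrite Px rnorm0 pmulr_rle0 ?divr_gt0 //.
  by rewrite -rnorm_eq0 => h; apply/eqP/le_anti; rewrite h rnorm_ge0.
have [g Pg] := choice (symmetric_surjective Pb sP (divr_gt0 b0 M0) bP).
have [G GE] := ex_linear (linear_of_injective P0 Pg).
have gP x : G (P x) = x.
  by apply/eqP; rewrite -subr_eq0; apply/eqP/P0; rewrite linearB GE Pg subrr.
have lV : linear (fun x => (M^-1)%:C *: S (G x)).
  by move=> a x y; rewrite !linearP.
have [V VE] := ex_linear lV.
have Viso x : rnorm (V x) = rnorm x.
  rewrite VE rnormZr -PS ger0_norm ?invr_ge0 ?ltW // mulrA mulVf ?mul1r ?gt_eqF //.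
  by rewrite GE Pg.
exists V; split=> // x.
have -> : S x = V (M%:C *: P x).
  by rewrite VE !linearZ /= gP scalerA -rmorphM divff ?gt_eqF // rmorph1 scale1r.
have lZ : linear (fun x => M%:C *: P x - ((M + b) / 2)%:C *: x).
  move=> a u v; rewrite (linearP P) (scalerDr _ _ (P v)) (scalerDr _ _ v).
  by rewrite opprD addrACA scalerBr !scalerA ![_ * a]mulrC.
have [Z ZE] := ex_linear lZ.
have -> : V (M%:C *: P x) - ((M + b) / 2)%:C *: V x = V (Z x).
  by rewrite ZE linearB !linearZ.
rewrite Viso.
move: x; apply: (symmetric_norm_le dotE) => [x y|x]; rewrite !ZE !rdotE ?sP //.
rewrite (rdotxx dotE) -sP.
have h1 : rdot (P x) x <= rnorm x ^+ 2.
  apply: le_trans (ler_norm _) _; apply: le_trans (rdot_le dotE _ _) _.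
  by rewrite expr2 ler_wpM2r ?rnorm_ge0.
(* The lower bound b/M <= P comes from ‖x - Px‖ <= (1 - b/M)‖x‖. *)
have h2 : b * rnorm x ^+ 2 <= M * rdot (P x) x.
  have : rdot (x - P x) x <= (1 - b / M) * rnorm x ^+ 2.
    apply: le_trans (ler_norm _) _; apply: le_trans (rdot_le dotE _ _) _.
    by rewrite expr2 mulrA ler_wpM2r ?rnorm_ge0.
  rewrite !rdotE (rdotxx dotE) -(ler_pM2l M0).
  have -> : M * ((1 - b / M) * rnorm x ^+ 2) = M * rnorm x ^+ 2 - b * rnorm x ^+ 2.
    by field; rewrite gt_eqF.
  lra.
have h3 : M * rdot (P x) x <= M * rnorm x ^+ 2 by rewrite ler_pM2l.
move: h2 h3; move: (rdot _ _) (rnorm x ^+ 2) => s t h2 h3.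
by rewrite ler_norml; apply/andP; split; nra.
Qed.

(* E is the kernel of |A| + A, where A = T*T - d^2 (up to a positive factor) and
   |A| is the square root of A^2. *)
Lemma spectral_subspace (T : {linear H -> H}) d : bounded_operator T -> 0 < d ->
  exists E : set H, [/\ subspace E, closed E,
    forall x, E x -> rnorm (T x) <= d * rnorm x,
    forall x, (forall y, E y -> dot y x = 0) -> d * rnorm x <= rnorm (T x) &
    forall x y, E x -> (forall z, E z -> dot z y = 0) -> dot (T x) (T y) = 0].
Proof.
move=> Tb d0.
have [T' [T'b hT']] := adjoint_exists dotE Tb.
have [M M0 hM] := bounded_operator_ge0 Tb.
have [M' M'0 hM'] := bounded_operator_ge0 T'b.
have d2 : 0 < d ^+ 2 by rewrite exprn_gt0.
(* This factor makes [A] a contraction, so that A^2 is at most 1. *)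
pose k := (M' * M + d ^+ 2)^-1.
have K0 : 0 < M' * M + d ^+ 2 by rewrite ltr_wpDl // mulr_ge0.
have k0 : 0 < k by rewrite invr_gt0.
have lA : linear (fun x => k%:C *: (T' (T x) - (d ^+ 2)%:C *: x)).
  move=> a x y; rewrite (linearP T) (linearP T') (scalerDr _ _ y) opprD addrACA.
  rewrite scalerDr; congr (_ + _); rewrite !scalerBr !scalerA.
  by congr (_ *: _ - _ *: _); rewrite -?mulrA [RHS]mulrC -?mulrA.
have [A AE] := ex_linear lA.
have AT x y : rdot (A x) y = k * (rdot (T x) (T y) - d ^+ 2 * rdot x y).
  by rewrite AE !rdotE (rdot_adjoint hT').
have sA x y : rdot (A x) y = rdot x (A y).
  by rewrite [RHS]rdotC !AT (rdotC _ x) (rdotC _ (T x)).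
have A1 x : rnorm (A x) <= rnorm x.
  rewrite AE rnormZr ger0_norm ?(ltW k0) // ler_pdivrMl //.
  apply: le_trans (rnormD _ _) _; rewrite rnormN rnormZr ger0_norm ?(ltW d2) //.
  rewrite mulrDl lerD2r -mulrA; apply: le_trans (hM' _) _.
  by rewrite ler_wpM2l.
have Ab : bounded_operator A by exists 1 => x; rewrite mul1r.
have lB : linear (A \o A) by move=> a x y; rewrite /= !linearP.
have [B BE] := ex_linear lB.
have sB x y : rdot (B x) y = rdot x (B y) by rewrite !BE /= !sA.
have hB x : 0 ^+ 2 * rnorm x ^+ 2 <= rdot (B x) x <= rnorm x ^+ 2.
  rewrite BE /= sA (rdotxx dotE) expr0n mul0r sqr_ge0 /=.
  by rewrite ler_pXn2r ?nnegrE ?rnorm_ge0.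
have mu01 : 0 <= (0 : R) <= 1 by rewrite lexx ler01.
have [J [JJ sJ J1 JC]] := sqrt_exists dotE mu01 sB hB.
have JA x : A (J x) = J (A x) by apply: JC => // z; rewrite !BE.
(* For mu = 0 the third clause of [sqrt_exists] reads ‖x - Jx‖ <= ‖x‖; squaring it gives
   positivity. *)
have Jpos x : 0 <= rdot (J x) x.
  have := J1 x; rewrite subr0 mul1r -(ler_pXn2r (n := 2)) ?nnegrE ?rnorm_ge0 //.
  rewrite (rnorm_sqrB dotE) rdotC; have := sqr_ge0 (rnorm (J x)); lra.
have lL : linear (fun x => A x + J x).
  by move=> a x y; rewrite !linearP scalerDr addrACA.
have [L LE] := ex_linear lL.
have Jn x : rnorm (J x) = rnorm (A x).
  apply/eqP; rewrite -(eqrXn2 (n := 2)) ?rnorm_ge0 // -!(rdotxx dotE).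
  by rewrite sJ JJ BE /= sA.
have Lb : bounded_operator L.
  exists 2 => x; rewrite LE; apply: le_trans (rnormD _ _) _.
  by rewrite Jn; have := A1 x; lra.
have LA x : L (A x) = A (L x) by rewrite !LE linearD JA.
have sE := subspace_ker L.
(* Invariance of the kernel under T*T makes the images of [E] and of its orthogonal complement
   orthogonal. *)
have TE x : ker L x -> ker L (T' (T x)).
  move=> Lx; have -> : T' (T x) = (k^-1)%:C *: A x + (d ^+ 2)%:C *: x.
    by rewrite AE scalerA -rmorphM mulVf ?gt_eqF // rmorph1 scale1r subrK.
  by apply: sE.2; [rewrite /ker /= LA Lx linear0 | apply: subspaceZ].
have AT2 x : rdot (A x) x = k * (rnorm (T x) ^+ 2 - (d * rnorm x) ^+ 2).
  by rewrite AT !(rdotxx dotE) exprMn.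
exists (ker L); split=> //.
- exact: closed_ker.
- move=> x; rewrite /ker /= LE => /eqP; rewrite addr_eq0 => /eqP AJ.
  have := Jpos x; rewrite -[J x]opprK -AJ rdotNl oppr_ge0 AT2 pmulr_rle0 //.
  by rewrite subr_le0 ler_pXn2r ?nnegrE ?mulr_ge0 ?rnorm_ge0 ?(ltW d0).
- move=> x ox.
  (* Since (A + J)(A - J) = A^2 - J^2 = 0, the range of A - J lies in the kernel of L, to which x is
     orthogonal; symmetry then gives (A - J)x = 0. *)
  have AJ : A x = J x.
    apply: (rdot_eq dotE) => z; apply/eqP; rewrite -subr_eq0 -rdotNr -rdotDr.
    rewrite rdotDr rdotNr -sA -sJ -rdotNl -rdotDl; apply/eqP/dot0_rdot/ox.
    rewrite /ker /= LE !linearB JA JJ BE /=.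
    by rewrite addrC addrA subrK subrr.
  have := Jpos x; rewrite -AJ AT2 pmulr_rge0 // subr_ge0.
  by rewrite ler_pXn2r ?nnegrE ?mulr_ge0 ?rnorm_ge0 ?(ltW d0).
- move=> x y Ex oy; apply: dot_eq0C.
  by rewrite hT'; apply: dot_eq0C; apply/oy/TE.
Qed.

End Polar.

(** * Orthonormal sequences and isometries *)

Section Orthonormal.
Variables (R : realType) (H : completeNormedModType R[i]).
Variable (dot : {dot H for @Num.conj R[i]}).
Hypothesis dotE : norm_induced_by dot.
Implicit Types (x y z : H) (a : R[i]) (r : R).

(* Zero vectors are allowed so that finite orthonormal families are also
   indexed by nat. *)
Definition orthonormal_or_zero (e : nat -> H) :=
  (forall k, rnorm (e k) = 0 \/ rnorm (e k) = 1) /\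
  forall i j, i <> j -> dot (e i) (e j) = 0.

Lemma dot_unit_or_zero x v :
  rnorm v = 0 \/ rnorm v = 1 -> dot x v * dot v v = dot x v.
Proof.
rewrite dotE normE => -[nv|->]; last by rewrite expr1n mulr1.
by move/eqP: nv; rewrite rnorm_eq0 => /eqP ->; rewrite dot0r mul0r.
Qed.

(** * Fourier series and Bessel's inequality *)

Section Series.
Variables (e f : nat -> H).
Hypotheses (ortho_e : orthonormal_or_zero e) (ortho_f : orthonormal_or_zero f).
Hypothesis norm_f : forall k, rnorm (f k) = rnorm (e k).

(* Partial sums of the operator mapping each e_k to g_k. *)
Definition transfer (g : nat -> H) n x := \sum_(k < n) dot x (e k) *: g k.

Lemma transfer_linear g n : linear (transfer g n).
Proof.
move=> a x y; rewrite /transfer scaler_sumr -big_split /=.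
by apply: eq_bigr => k _; rewrite dotDl dotZl scalerDl scalerA.
Qed.

Lemma transferS g n x : transfer g n.+1 x = transfer g n x + dot x (e n) *: g n.
Proof. by rewrite /transfer big_ord_recr. Qed.

Lemma transfer_dot0 g n x y :
  (forall k, (k < n)%N -> dot (g k) y = 0) -> dot (transfer g n x) y = 0.
Proof.
elim: n => [|n ih] gy; first by rewrite /transfer big_ord0 dot0l.
rewrite transferS dotDl dotZl gy // mulr0 addr0 ih // => k kn.
by apply: gy; apply: ltnW.
Qed.

Lemma transfer_residual n k x :
  (k < n)%N -> dot (x - transfer e n x) (e k) = 0.
Proof.
move=> kn; rewrite dotBl; elim: n kn => // n ih; rewrite ltnS leq_eqVlt.
rewrite transferS dotDl dotZl => /orP[/eqP ->|kn].
  rewrite (dot_unit_or_zero _ (ortho_e.1 n)) transfer_dot0 ?add0r ?subrr //.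
  move=> j jn.
  by apply: ortho_e.2 => jn'; rewrite jn' ltnn in jn.
rewrite (ortho_e.2 n k) ?mulr0 ?addr0 ?ih // => nk.
by rewrite nk ltnn in kn.
Qed.

Definition fourier_mass x n : R := \sum_(k < n) rnorm (dot x (e k) *: e k) ^+ 2.

(** By Pythagoras the right-hand side depends on [e] only. Hence all partial sums with targets
    normed like [e] converge together and have equal norms. *)
Lemma transfer_dist (g : nat -> H) m n x : orthonormal_or_zero g ->
  (forall k, rnorm (g k) = rnorm (e k)) -> (m <= n)%N ->
  rnorm (transfer g n x - transfer g m x) ^+ 2 =
  fourier_mass x n - fourier_mass x m.
Proof.
move=> og ng /subnK <-; elim: (n - m)%N => [|k ih].
  by rewrite !subrr rnorm0 expr0n.
rewrite addSn transferS addrAC (rnorm_sqrD0 dotE) ?ih //.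
  by rewrite /fourier_mass big_ord_recr /= !rnormZ ng addrAC.
rewrite dotZr dotBl !transfer_dot0 ?subrr ?mulr0 // => i.
  by move=> im; apply: og.2 => E; move: im; rewrite E ltnNge leq_addl.
by move=> im; apply: og.2 => E; move: im; rewrite E ltnn.
Qed.

Lemma fourier_mass_homo x :
  {homo fourier_mass x : m n / (m <= n)%N >-> m <= n}.
Proof.
move=> m n mn; rewrite -subr_ge0 -(transfer_dist x ortho_e) //; exact: sqr_ge0.
Qed.

(** Pythagoras for the partial sum and its residual, which are orthogonal. *)
Lemma bessel x n : fourier_mass x n <= rnorm x ^+ 2.
Proof.
have := transfer_dist x ortho_e (fun=> erefl) (leq0n n).
rewrite /fourier_mass {2}/transfer !big_ord0 !subr0 => <-.
rewrite -[in leRHS](subrK (transfer e n x) x) (rnorm_sqrD0 dotE) ?lerDr ?sqr_ge0 //.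
by apply: dot_eq0C; apply: transfer_dot0 => k kn; apply/dot_eq0C/transfer_residual.
Qed.

Lemma transfer_cvg (g : nat -> H) : orthonormal_or_zero g ->
  (forall k, rnorm (g k) = rnorm (e k)) ->
  exists L : {linear H -> H}, forall x, (transfer g)^~ x @ \oo --> L x.
Proof.
move=> og ng; apply: pointwise_limit_linear => [|x]; first exact: transfer_linear.
apply: rnorm_complete => eps eps0; have eps2 : 0 < eps ^+ 2 by rewrite exprn_gt0.
have [N hN] := bounded_monotone_cauchy (@fourier_mass_homo x) (bessel x) eps2.
exists N => n Nn; rewrite -(ltr_pXn2r (n := 2)) ?nnegrE ?rnorm_ge0 ?(ltW eps0) //.
by rewrite transfer_dist // hN.
Qed.

(** W x is the sum of the <x, e_k> f_k. It is compared with the Fourier series X x of x itself,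
    whose partial sums have the same norms and which equals x on [E]. The last clause says that W
    takes values in the closed span of the f_k. *)
Lemma isometry_of_orthonormal (E : set H) : subspace E -> closed E ->
  (forall k, E (e k)) ->
  (forall x, E x -> (forall k, dot x (e k) = 0) -> x = 0) ->
  exists W : {linear H -> H}, (forall x, E x -> rnorm (W x) = rnorm x) /\
    forall x z, (forall k, dot (f k) z = 0) -> dot (W x) z = 0.
Proof.
move=> sE cE eE complete_e.
have [W hW] := transfer_cvg ortho_f norm_f.
have [X hX] := transfer_cvg ortho_e (fun=> erefl).
exists W; split=> [x Ex|x z fz]; last first.
  have cz := @closed_dot0 _ _ _ dotE z.
  by apply: (@closed_seq _ _ _ _ _ cz _ (hW x)) => n; apply: transfer_dot0.
have XE : E (X x).
  apply: (closed_seq cE _ (hX x)) => n; elim: n => [|n ih].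
    by rewrite /transfer big_ord0; exact: sE.1.
  by rewrite transferS; apply: subspaceD => //; apply: subspaceZ.
have Xx : X x = x.
  apply/eqP; rewrite eq_sym -subr_eq0; apply/eqP/complete_e.
    exact: subspaceB.
  move=> k; have ck := @closed_dot0 _ _ _ dotE (e k).
  (* The shift by k + 1 makes every partial sum include the term of index k. *)
  have h : (fun n => x - transfer e (n + k.+1) x) @ \oo --> x - X x.
    by apply: cvgB; [apply: cvg_cst | rewrite (cvg_shiftn _ ((transfer e)^~ x))].
  apply: (@closed_seq _ _ _ _ _ ck _ h) => n.
  by apply: transfer_residual; rewrite addnS ltnS leq_addl.
rewrite -[in RHS]Xx; apply: (cvg_eq_unique _ (cvg_rnorm (hW x)) (cvg_rnorm (hX x))).
move=> n; apply/eqP; rewrite -(eqrXn2 (n := 2)) ?rnorm_ge0 //; apply/eqP.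
have := transfer_dist x ortho_e (fun=> erefl) (leq0n n).
have := transfer_dist x ortho_f norm_f (leq0n n).
by rewrite /transfer !big_ord0 !subr0 => -> ->.
Qed.

End Series.

(** * The Gram-Schmidt process *)

Section GramSchmidt.
Variable d : nat -> H.

(** Zero is sent to zero, so a vector depending linearly on its predecessors produces a zero entry,
    as [orthonormal_or_zero] allows. *)
Definition normalize x := ((rnorm x)^-1)%:C *: x.

(** The projection onto the span of the first n vectors carries the recursion, so that
    [gram_schmidt] can be defined from it directly. *)
Fixpoint gs_proj (n : nat) : H -> H :=
  if n is n'.+1 then
    let v := normalize (d n' - gs_proj n' (d n')) in
    fun x => gs_proj n' x + dot x v *: v
  else fun=> 0.

Definition gram_schmidt n := normalize (d n - gs_proj n (d n)).

Lemma rnorm_normalize x : x != 0 -> rnorm (normalize x) = 1.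
Proof.
rewrite -rnorm_gt0 => x0.
by rewrite rnormZr ger0_norm ?invr_ge0 ?(ltW x0) // mulVf // gt_eqF.
Qed.

Lemma normalize0 : normalize 0 = 0.
Proof. exact: scaler0. Qed.

Lemma gs_projE n x : gs_proj n x = transfer gram_schmidt gram_schmidt n x.
Proof.
elim: n => [|n ih] /=; first by rewrite /transfer big_ord0.
by rewrite transferS ih.
Qed.

Lemma gram_schmidt_unit k :
  rnorm (gram_schmidt k) = 0 \/ rnorm (gram_schmidt k) = 1.
Proof.
rewrite /gram_schmidt; have [->|v0] := eqVneq (d k - gs_proj k (d k)) 0.
  by left; rewrite normalize0 rnorm0.
by right; rewrite rnorm_normalize.
Qed.

(** [transfer_residual] presupposes orthogonality, which is derived from the present lemma. The
    induction works because each new vector is a multiple of a residual, hence orthogonal to the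
    earlier ones. *)
Lemma gs_proj_residual n k x :
  (k < n)%N -> dot (x - gs_proj n x) (gram_schmidt k) = 0.
Proof.
elim: n k x => // n ih k x kn /=; rewrite -/(gram_schmidt n).
have en j : (j < n)%N -> dot (gram_schmidt n) (gram_schmidt j) = 0.
  by move=> jn; rewrite dotZl ih ?mulr0.
rewrite opprD addrA dotBl dotZl; move: kn.
rewrite ltnS leq_eqVlt => /orP[/eqP ->|kn].
  rewrite (dot_unit_or_zero _ (gram_schmidt_unit n)) dotBl gs_projE.
  rewrite transfer_dot0 ?subr0 ?subrr // => j jn.
  exact/dot_eq0C/en.
by rewrite ih // en // mulr0 subrr.
Qed.

Lemma gram_schmidt_ortho : orthonormal_or_zero gram_schmidt.
Proof.
split=> [|i j ij]; first exact: gram_schmidt_unit.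
have lt_ortho m n : (m < n)%N -> dot (gram_schmidt n) (gram_schmidt m) = 0.
  by move=> mn; rewrite dotZl gs_proj_residual // mulr0.
have [ltij|ltji|//] := ltngtP i j; last exact: lt_ortho.
exact/dot_eq0C/lt_ortho.
Qed.

(** Each d_k is a combination of the Gram-Schmidt vectors up to index k. *)
Lemma gram_schmidt_complete x :
  (forall k, dot x (gram_schmidt k) = 0) -> forall k, dot x (d k) = 0.
Proof.
move=> hx k; rewrite -(subrK (gs_proj k (d k)) (d k)) dotDr.
rewrite gs_projE [X in _ + X]dot_eq0C ?addr0; last first.
  by apply: transfer_dot0 => j _; apply: dot_eq0C.
rewrite -gs_projE; have [->|v0] := eqVneq (d k - gs_proj k (d k)) 0.
  by rewrite dot0r.
have := hx k; rewrite dotZr conjc_real => /eqP.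
rewrite mulf_eq0 -[X in _ == X](rmorph0 (real_complex R)) (inj_eq (@complexI R)).
by rewrite invr_eq0 rnorm_eq0 (negPf v0) => /eqP.
Qed.

Lemma gram_schmidt_in (E : set H) :
  subspace E -> (forall k, E (d k)) -> forall k, E (gram_schmidt k).
Proof.
move=> sE dE k; apply: (subspaceZ _ sE); apply: (subspaceB sE) => //.
elim: k (d k) => [|k ih] x /=; first exact: sE.1.
apply: subspaceD => //; apply: (subspaceZ _ sE); apply: (subspaceZ _ sE).
exact: subspaceB.
Qed.

End GramSchmidt.

(** Project a countable dense set to [E] and orthonormalize. A vector of [E] orthogonal to the
    projections is orthogonal to the dense set itself. *)
Lemma separable_orthonormal_basis (E : set H) :
  separable H -> subspace E -> closed E -> exists e : nat -> H,
  [/\ orthonormal_or_zero e, forall k, E (e k) &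
      forall x, E x -> (forall k, dot x (e k) = 0) -> x = 0].
Proof.
move=> [D cD dD] sE cE.
have [d hd] : exists d : nat -> H, forall x, D x -> exists n, d n = x.
  have /countable_injP[h hinj] := cD.
  exists (fun n => xget 0 [set x | D x /\ h x = n]) => x Dx; exists (h x).
  case: xgetP => [y _ [Dy hy]|no]; last by case: (no x).
  by apply: hinj; rewrite ?inE.
have [P hP] := projection_exists dotE sE cE.
exists (gram_schmidt (P \o d)); split.
- exact: gram_schmidt_ortho.
- by apply: gram_schmidt_in => // k; case: (hP (d k)).
- move=> x Ex /gram_schmidt_complete hx.
  apply: (dot_self0 dotE); apply: contrapT => xx.
  have cx := @closed_dot0 _ _ _ dotE x.
  have oN : open (~` [set y | dot y x = 0]) by rewrite openC.
  (* If x were nonzero, the open set of vectors not orthogonal to x would contain x and hence meet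
     [D]. *)
  have nN : ~` [set y | dot y x = 0] !=set0 by exists x.
  have [y [Ny Dy]] := dD _ nN oN; apply: Ny => /=.
  have [n dn] := hd _ Dy; apply: dot_eq0C; rewrite -dn.
  by rewrite -(subrK (P (d n)) (d n)) dotDr (hP (d n)).2 // hx addr0.
Qed.

End Orthonormal.

(** * The isometry from ker T to ker T* given by the index condition *)

Section IndexIsometry.
Variables (R : realType) (H : completeNormedModType R[i]).
Variable (dot : {dot H for @Num.conj R[i]}).
Hypothesis dotE : norm_induced_by dot.
Implicit Types (x y z : H) (a : R[i]) (r : R).

(** Distinct orthonormal vectors are at distance sqrt 2 > 1, so points of [D] chosen within 1/2 of
    them are distinct. *)
Lemma orthonormal_set_countable (E : set H) :
  separable H -> orthonormal_set dot E -> countable E.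
Proof.
move=> [D cD dD] [nE oE].
have h x : exists y, D y /\ rnorm (x - y) < 2^-1.
  have x_ball : ball x ((2^-1 : R)%:C) !=set0.
    by exists x; apply: ballxx; rewrite ltcR invr_gt0.
  have [y [By Dy]] := dD _ x_ball (@ball_open _ _ _ _).
  by exists y; split=> //; move: By; rewrite -ball_normE /= normE ltcR.
have [g hg] := choice h.
have /countable_injP[k kinj] := cD.
apply/countable_injP; exists (k \o g) => x y; rewrite !inE => Ex Ey /= kxy.
have gxy : g x = g y by apply: kinj; rewrite ?inE //; case: (hg x); case: (hg y).
apply: contrapT => xy.
have n1 z : E z -> rnorm z = 1 by move=> /nE nz; rewrite /rnorm nz.
have d1 : rnorm (x - y) < 1.
  rewrite -(subrKA (g x)); apply: le_lt_trans (rnormD _ _) _.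
  rewrite {2}gxy (rnormBC (g y)); have := (hg x).2; have := (hg y).2; lra.
have : rnorm (x - y) ^+ 2 < 1 by rewrite expr_lt1 // rnorm_ge0.
rewrite (rnorm_sqrB dotE) !n1 // (dot0_rdot (oE _ _ Ex Ey xy)); lra.
Qed.

(** An injection from a basis of ker T to one of ker T* is turned into two sequences indexed by nat,
    and [isometry_of_orthonormal] extends it linearly. *)
Lemma index_le0_isometry (T : {linear H -> H}) :
  separable H -> bounded_operator T -> index_le0 dot T ->
  exists W : {linear H -> H}, (forall x, ker T x -> rnorm (W x) = rnorm x) /\
    forall x z, dot (W x) (T z) = 0.
Proof.
move=> Hsep Tb [E [F [[oE clE] [oF clF] EF]]].
have /countable_injP[h hinj] := orthonormal_set_countable Hsep oE.
have /pcard_leP/injfunPex[g gF ginj] := EF.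
have n1 (A : set H) z : orthonormal_set dot A -> A z -> rnorm z = 1.
  by move=> [nA _] /nA nz; rewrite /rnorm nz.
have n0 (A : set H) : orthonormal_set dot A -> ~ A 0.
  by move=> oA /(n1 _ _ oA); rewrite rnorm0 => /eqP; rewrite eq_sym oner_eq0.
(* The injection [h] numbers the vectors of [E]; indices that it does not reach carry 0. *)
pose e n := xget 0 [set x | E x /\ h x = n].
have eP n : (E (e n) /\ h (e n) = n) \/ e n = 0.
  by rewrite /e; case: xgetP => [x -> []|_]; [left|right].
have eh x : E x -> e (h x) = x.
  move=> Ex; rewrite /e; case: xgetP => [y _ [Ey hy]|no].
    by apply: hinj; rewrite ?inE.
  by case: (no x).
(* [f] vanishes at the same indices as [e], so that norms match. *)
pose f n := if `[< E (e n) >] then g (e n) else 0.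
have fP n : (E (e n) /\ f n = g (e n)) \/ (e n = 0 /\ f n = 0).
  rewrite /f; case: asboolP => [En|nEn]; first by left.
  by right; split=> //; case: (eP n) => // -[].
have oe : orthonormal_or_zero dot e.
  split=> [k|i j ij].
    by case: (eP k) => [[Ek _]|->]; [right; apply: n1 oE Ek|left; rewrite rnorm0].
  case: (eP i) => [[Ei hi]|->]; last by rewrite dot0l.
  case: (eP j) => [[Ej hj]|->]; last by rewrite dot0r.
  by apply: oE.2 => // eij; apply: ij; rewrite -hi -hj eij.
have of_ : orthonormal_or_zero dot f.
  split=> [k|i j ij].
    case: (fP k) => [[Ek ->]|[_ ->]]; last by left; rewrite rnorm0.
    by right; apply: n1 oF _; exact: gF.
  case: (fP i) => [[Ei ->]|[_ ->]]; last by rewrite dot0l.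
  case: (fP j) => [[Ej ->]|[_ ->]]; last by rewrite dot0r.
  apply: oF.2; [exact: gF|exact: gF|move=> /ginj eij].
  apply: ij; case: (eP i) => [[_ <-]|ei]; last by case: (n0 _ oE); rewrite -ei.
  case: (eP j) => [[_ <-]|ej]; last by case: (n0 _ oE); rewrite -ej.
  by rewrite eij ?inE.
have nf k : rnorm (f k) = rnorm (e k).
  case: (fP k) => [[Ek ->]|[-> ->]] //.
  by rewrite (n1 _ _ oE Ek) (n1 _ _ oF (gF _ Ek)).
have sub_span (A : set H) x : A x -> closure (linspan A) x.
  move=> Ax; apply: subset_closure; exists 1%N, (fun=> 1), (fun=> x).
  by split=> //; rewrite big_ord1 scale1r.
have kE k : ker T (e k).
  by case: (eP k) => [[Ek _]|->]; [rewrite -clE; exact: sub_span|exact: linear0].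
have complete_e x : ker T x -> (forall k, dot x (e k) = 0) -> x = 0.
  move=> Tx xe; apply: (dot_self0 dotE).
  have cx := @closed_dot0 _ _ _ dotE x.
  suff : [set y | dot y x = 0] x by [].
  move: Tx; rewrite -clE => clx; apply: cx; move: x clx xe => x + xe.
  apply: closure_subset => _ [n [c [v [Ev ->]]]] /=.
  elim/big_ind: _ => [|y z y0 z0|k _]; rewrite ?dot0l ?dotDl ?y0 ?z0 ?addr0 //.
  by rewrite dotZl (@dot_eq0C _ _ _ x) ?mulr0 // -(eh _ (Ev k)).
have [T' [T'b hT']] := adjoint_exists dotE Tb.
(* The value chosen by [xget] satisfies the equation of the adjoint, since T' y is a solution. *)
have Fadj y z : F y -> dot (T z) y = 0.
  move=> /sub_span; rewrite clF /ker /= /adjoint; case: xgetP => [w _ hw w0|no].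
    by rewrite hw w0 dot0r.
  by case: (no (T' y)) => x /=.
have [W [W1 W2]] := isometry_of_orthonormal dotE oe of_ nf (subspace_ker T)
  (closed_ker Tb) kE complete_e.
exists W; split=> // x z; apply: W2 => k; apply: dot_eq0C.
by case: (fP k) => [[Ek ->]|[_ ->]]; [apply: Fadj; exact: gF|exact: dot0r].
Qed.

End IndexIsometry.

(** * Approximation by operators that are bounded below *)

Section BoundedBelow.
Variables (R : realType) (H : completeNormedModType R[i]).
Variable (dot : {dot H for @Num.conj R[i]}).
Hypothesis dotE : norm_induced_by dot.
Implicit Types (x y z : H) (a : R[i]) (r : R).

Definition bounded_below_on (K : set H) (T : H -> H) :=
  exists2 b : R, 0 < b & forall x, K x -> b * rnorm x <= rnorm (T x).

(** Pythagoras applied to both sums. *)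
Lemma bounded_below_sum p q u v (b d : R) : dot p q = 0 -> dot u v = 0 ->
  0 < b -> 0 < d -> b * rnorm p <= rnorm u -> d * rnorm q <= rnorm v ->
  Num.min b d * rnorm (p + q) <= rnorm (u + v).
Proof.
move=> pq uv b0 d0 bp dq.
have m0 : 0 < Num.min b d by rewrite lt_min b0.
rewrite -(ler_pXn2r (n := 2)) ?nnegrE ?mulr_ge0 ?rnorm_ge0 ?(ltW m0) //.
rewrite exprMn !(rnorm_sqrD0 dotE) // mulrDr -!exprMn lerD //.
  rewrite ler_pXn2r ?nnegrE ?mulr_ge0 ?rnorm_ge0 ?(ltW m0) //.
  by apply: le_trans bp; rewrite ler_wpM2r ?rnorm_ge0 // ge_min lexx.
rewrite ler_pXn2r ?nnegrE ?mulr_ge0 ?rnorm_ge0 ?(ltW m0) //.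
by apply: le_trans dq; rewrite ler_wpM2r ?rnorm_ge0 // ge_min lexx orbT.
Qed.

(** * Orthonormal sequences in the image of an operator that is not bounded below *)

Section OrthonormalImages.
Variables (T : {linear H -> H}) (K : set H).
Hypotheses (sK : subspace K) (inj_T : forall x, K x -> T x = 0 -> x = 0).
Hypothesis not_bounded_below : ~ bounded_below_on K T.

(** Gram-Schmidt is applied to the images under T, but the subtraction takes place on preimages, so
    that the result stays in [K]. *)
Fixpoint residual (l : seq H) x :=
  if l is y :: l' then residual l' x - dot (T x) (T y) *: y else x.

Fixpoint orthonormal_images (l : seq H) : Prop :=
  if l is y :: l' then
    [/\ K y, rnorm (T y) = 1, forall z, z \in l' -> dot (T z) (T y) = 0 &
        orthonormal_images l']
  else True.

Lemma residual_in l x : orthonormal_images l -> K x -> K (residual l x).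
Proof.
elim: l => //= y l ih [Ky _ _ ol] Kx.
by apply: (subspaceB sK); [exact: ih | exact: subspaceZ].
Qed.

Lemma dot_residual l x w : (forall z, z \in l -> dot (T z) w = 0) ->
  dot (T (residual l x)) w = dot (T x) w.
Proof.
elim: l => //= y l ih lw; rewrite linearB linearZ dotBl dotZl.
rewrite (lw y) ?mem_head // mulr0 subr0 ih // => z zl.
by rewrite lw // inE zl orbT.
Qed.

Lemma residual_ortho l x y : orthonormal_images l -> y \in l ->
  dot (T (residual l x)) (T y) = 0.
Proof.
elim: l => //= z l ih [Kz nz lz ol]; rewrite linearB linearZ dotBl dotZl inE.
case/orP=> [/eqP ->|yl].
  by rewrite dot_residual // dotE normE nz expr1n mulr1 subrr.
by rewrite ih // [dot (T z) _]dot_eq0C ?mulr0 ?subrr //; apply: lz.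
Qed.

(** The correction is bounded in terms of T x rather than x, because its coefficients are the <Tx,
    Ty>. *)
Lemma residual_dist l : exists2 C : R, 0 <= C &
  forall x, rnorm (x - residual l x) <= C * rnorm (T x).
Proof.
elim: l => [|y l [C C0 hC]] /=.
  by exists 0 => // x; rewrite subrr rnorm0 mul0r.
exists (C + rnorm (T y) * rnorm y) => [|x].
  by rewrite addr_ge0 // mulr_ge0 // rnorm_ge0.
rewrite opprB addrCA addrC; apply: le_trans (rnormD _ _) _.
rewrite mulrDl lerD // rnormZ mulrAC ler_wpM2r ?rnorm_ge0 // mulrC.
by rewrite -lecR -normCE dot_le.
Qed.

(* If no vector of K can be added to l, then residual l vanishes on K, and
   residual_dist bounds T from below. *)
Lemma orthonormal_images_extend l : orthonormal_images l ->
  exists x, [/\ K x, rnorm (T x) = 1 & forall z, z \in l -> dot (T z) (T x) = 0].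
Proof.
move=> ol; apply: contrapT => nox; apply: not_bounded_below.
have [C C0 hC] := residual_dist l.
exists (C + 1)^-1 => [|x Kx]; first by rewrite invr_gt0 ltr_wpDl.
have rx0 : residual l x = 0.
  have Kr := residual_in ol Kx.
  apply: inj_T => //; apply/eqP; rewrite -rnorm_eq0; apply/negPn/negP => r0.
  have rp : 0 < rnorm (T (residual l x)) by rewrite lt_def r0 rnorm_ge0.
  apply: nox; exists ((rnorm (T (residual l x)))^-1%:C *: residual l x); split.
  - exact: subspaceZ.
  - by rewrite linearZ rnormZr ger0_norm ?invr_ge0 ?(ltW rp) // mulVf.
  - move=> z zl; apply: dot_eq0C.
    by rewrite linearZ dotZl residual_ortho // mulr0.
have := hC x; rewrite rx0 subr0 ler_pdivrMl ?ltr_wpDl // => /le_trans; apply.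
by rewrite ler_wpM2r ?rnorm_ge0 // lerDl.
Qed.

Lemma orthonormal_images_seq : exists f : nat -> H,
  [/\ forall k, exists2 x, K x & f k = T x, forall k, rnorm (f k) = 1 &
      forall i j, i <> j -> dot (f i) (f j) = 0].
Proof.
(* The condition on [l] is put under the existential, with 0 as default, so that [choice] gives a
   total function. *)
have extend l : exists x, orthonormal_images l ->
    [/\ K x, rnorm (T x) = 1 & forall z, z \in l -> dot (T z) (T x) = 0].
  have [/orthonormal_images_extend[x hx]|nol] := pselect (orthonormal_images l).
    by exists x.
  by exists 0 => /nol.
have [next hnext] := choice extend.
pose g := fix g n := if n is n'.+1 then next (g n') :: g n' else [::].
have og n : orthonormal_images (g n).
  by elim: n => //= n ih; have [h1 h2 h3] := hnext _ ih.
have gmem m n : (m < n)%N -> next (g m) \in g n.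
  elim: n => // n ih; rewrite ltnS leq_eqVlt => /orP[/eqP ->|mn].
    exact: mem_head.
  by rewrite inE ih ?orbT.
have lt_ortho m n : (m < n)%N -> dot (T (next (g m))) (T (next (g n))) = 0.
  by move=> mn; have [_ _] := hnext _ (og n); apply; exact: gmem.
exists (fun n => T (next (g n))); split=> [k|k|i j ij].
- by exists (next (g k)) => //; case: (hnext _ (og k)).
- by case: (hnext _ (og k)).
- have [|ji|//] := ltngtP i j; first exact: lt_ortho.
  exact/dot_eq0C/lt_ortho.
Qed.

End OrthonormalImages.

(** With P the projection onto [E], take S = T(1 - P) + d W P. Its two terms have orthogonal values
    and are bounded below, and T - S = TP - d W P has norm at most 2d. *)
Lemma bounded_below_perturbation (T W : {linear H -> H}) (E : set H) (d : R) :
  bounded_operator T -> subspace E -> closed E -> 0 < d ->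
  bounded_below_on [set x | forall y, E y -> dot y x = 0] T ->
  (forall x, E x -> rnorm (T x) <= d * rnorm x) ->
  (forall x, E x -> rnorm (W x) = rnorm x) ->
  (forall x z, (forall y, E y -> dot y z = 0) -> dot (W x) (T z) = 0) ->
  exists S : {linear H -> H}, bounded_below_on setT S /\
    forall x, rnorm (T x - S x) <= 2 * d * rnorm x.
Proof.
move=> Tb sE cE d0 [b b0 hb] Td W1 W2.
have [P hP] := projection_exists dotE sE cE.
have EP x : E (P x) by case: (hP x).
have oP x y : E y -> dot y (x - P x) = 0 by case: (hP x) => _; apply.
have lS : linear (fun x => T (x - P x) + d%:C *: W (P x)).
  move=> a x y; rewrite (linearP P) opprD addrACA -scalerBr (linearP T) (linearP W).
  by rewrite scalerDr addrACA !scalerA mulrC -!scalerA -scalerDr.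
have [S SE] := ex_linear lS.
have P1 x : rnorm (P x) <= rnorm x.
  rewrite -(ler_pXn2r (n := 2)) ?nnegrE ?rnorm_ge0 //.
  rewrite -[in leRHS](subrK (P x) x) [in leRHS]addrC (rnorm_sqrD0 dotE) ?oP //.
  by rewrite lerDl sqr_ge0.
exists S; split.
  exists (Num.min b d) => [|x _]; first by rewrite lt_min b0.
  rewrite -[in leLHS](subrK (P x) x) SE; apply: bounded_below_sum => //.
  - exact/dot_eq0C/oP.
  - by apply: dot_eq0C; rewrite dotZl W2 ?mulr0 // => y; apply: oP.
  - by apply: hb => y; apply: oP.
  - by rewrite rnormZr ger0_norm ?(ltW d0) // W1.
move=> x; rewrite SE linearB opprD opprB addrA subrKC.
apply: le_trans (rnormD _ _) _; rewrite rnormN rnormZr ger0_norm ?(ltW d0) // W1 //.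
have := Td _ (EP x); have := P1 x; rewrite -(ler_pM2l d0); lra.
Qed.

Lemma bounded_below_approx (T : {linear H -> H}) (d : R) :
  separable H -> bounded_operator T -> ~ closed (range T) \/ index_le0 dot T ->
  0 < d -> exists S : {linear H -> H}, bounded_below_on setT S /\
    forall x, rnorm (T x - S x) <= 2 * d * rnorm x.
Proof.
move=> Hsep Tb hT d0.
pose N := [set x | forall y, ker T y -> dot y x = 0].
have sN : subspace N.
  split=> [y _|a x y Nx Ny z Tz]; first by rewrite dot0r.
  by rewrite dotDr dotZr Nx // Ny // mulr0 addr0.
(* If T is bounded below on the complement of its kernel, its range is closed, so the index
   condition must hold. *)
have [bbT|nbbT] := pselect (bounded_below_on N T).
  have [b b0 hb] := bbT.
  have idx : index_le0 dot T.
    case: hT => // ncl; case: ncl; apply: (@closed_range _ _ T N b) => // x.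
    have [P hP] := projection_exists dotE (subspace_ker T) (closed_ker Tb).
    exists (x - P x); first by move=> y Ty; apply: (hP x).2.
    by rewrite linearB (hP x).1 subr0.
  have [W [W1 W2]] := index_le0_isometry dotE Hsep Tb idx.
  apply: (@bounded_below_perturbation T W (ker T)) => //.
  - exact: subspace_ker.
  - exact: closed_ker.
  - by move=> x ->; rewrite rnorm0 mulr_ge0 ?rnorm_ge0 ?(ltW d0).
have [E [sE cE Ed Eb Eo]] := spectral_subspace dotE Tb d0.
have [P hP] := projection_exists dotE sE cE.
have EP x : E (P x) by case: (hP x).
have oP x y : E y -> dot y (x - P x) = 0 by case: (hP x) => _; apply.
(* For x in ker T, T(x - Px) equals -T(Px) and is therefore orthogonal to itself; as T is bounded
   below on the complement of [E], x = Px. *)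
have kerE x : ker T x -> E x.
  move=> Tx; suff -> : x = P x by [].
  apply/eqP; rewrite -subr_eq0 -rnorm_eq0; apply/eqP/le_anti.
  rewrite rnorm_ge0 andbT -(pmulr_rle0 _ d0).
  apply: le_trans (Eb _ (fun y => @oP x y)) _.
  suff -> : T (x - P x) = 0 by rewrite rnorm0.
  have TP : T (x - P x) = - T (P x) by rewrite linearB Tx sub0r.
  apply: (dot_self0 dotE); rewrite {2}TP.
  apply: dot_eq0C; rewrite -[- T (P x)]linearN; apply: Eo => [|y]; last exact: oP.
  by rewrite -scaleN1r; apply: subspaceZ.
pose K := E `&` N.
have sK : subspace K.
  split=> [|a x y [Ex Nx] [Ey Ny]]; first by split; [exact: sE.1|exact: sN.1].
  by split; [exact: sE.2|exact: sN.2].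
have injK x : K x -> T x = 0 -> x = 0.
  by move=> [_ Nx] Tx; apply: (dot_self0 dotE); apply: Nx.
(* A vector x of [N] splits into P x, which lies in [K], and a vector orthogonal to [E], with
   orthogonal images. A lower bound on [K] would thus extend to [N]. *)
have nbbK : ~ bounded_below_on K T.
  move=> [b b0 hb]; apply: nbbT; exists (Num.min b d) => [|x Nx].
    by rewrite lt_min b0.
  rewrite -(subrK (P x) x) addrC linearD; apply: bounded_below_sum => //.
  - exact: oP.
  - by apply: Eo => // y; apply: oP.
  - apply: hb; split=> // k Tk; have := Nx k Tk.
    by rewrite -{1}(subrK (P x) x) dotDr oP ?add0r //; apply: kerE.
  - by apply: Eb => y; apply: oP.
have [f [fK f1 fo]] := orthonormal_images_seq sK injK nbbK.
have [e [oe Ee ce]] := separable_orthonormal_basis dotE Hsep sE cE.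
(* The factor copies the zeros of [e], so that the two sequences have the same norms. *)
pose g k := (rnorm (e k))%:C *: f k.
have ng k : rnorm (g k) = rnorm (e k).
  by rewrite rnormZr f1 mulr1 ger0_norm ?rnorm_ge0.
have og : orthonormal_or_zero dot g.
  split=> [k|i j ij]; first by rewrite ng; exact: oe.1.
  by rewrite dotZl dotZr fo // !mulr0.
have [W [W1 W2]] := isometry_of_orthonormal dotE oe og ng sE cE Ee ce.
apply: (@bounded_below_perturbation T W E) => //; first by exists d.
move=> x z zE; apply: W2 => k; rewrite dotZl; have [y [Ey _] ->] := fK k.
by rewrite Eo ?mulr0.
Qed.

End BoundedBelow.

(** * The distance and the AOP constant *)

Section DistanceAOP.
Variables (R : realType) (H : completeNormedModType R[i]).
Variable (dot : {dot H for @Num.conj R[i]}).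
Hypothesis dotE : norm_induced_by dot.
Implicit Types (x y z : H) (a : R[i]) (r : R) (T : {linear H -> H}).

Local Notation rdot := (re_dot dot).
Local Notation rdotE := (rdotE dot).

Lemma ex_unit_vector : hdim_ge dot [set: H] 2 -> exists u : H, rnorm u = 1.
Proof.
move=> [E [[nE _] _] hE].
have [E0|/set0P[u Eu]] := eqVneq E set0; last by exists u; rewrite /rnorm nE.
by move: hE; rewrite E0 card_le0 => /eqP/seteqP[/(_ 0%N)/(_ isT)].
Qed.

Lemma has_sup_opnorm T : bounded_operator T ->
  has_sup [set rnorm (T x) | x in [set x : H | rnorm x <= 1]].
Proof.
move=> Tb; have [K K0 hK] := bounded_operator_ge0 Tb.
split; first by exists (rnorm (T 0)), 0 => //=; rewrite rnorm0.
exists K => _ [x /= x1 <-]; apply: le_trans (hK x) _.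
by rewrite -[leRHS]mulr1 ler_wpM2l.
Qed.

Lemma rnorm_le_opnorm T x :
  bounded_operator T -> rnorm (T x) <= opnorm T * rnorm x.
Proof.
move=> /has_sup_opnorm[_ ubT].
have [->|x0] := eqVneq x 0; first by rewrite linear0 rnorm0 mulr0.
have nx : 0 < rnorm x by rewrite rnorm_gt0.
rewrite -ler_pdivrMr // mulrC.
have -> : (rnorm x)^-1 * rnorm (T x) = rnorm (T ((rnorm x)^-1%:C *: x)).
  by rewrite linearZ rnormZr ger0_norm // invr_ge0 ltW.
apply: ub_le_sup => //; exists ((rnorm x)^-1%:C *: x) => //=.
by rewrite rnormZr ger0_norm ?invr_ge0 ?(ltW nx) // mulVf // gt_eqF.
Qed.

Lemma opnorm_le (A : H -> H) (K : R) : 0 <= K ->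
  (forall x, rnorm (A x) <= K * rnorm x) -> opnorm A <= K.
Proof.
move=> K0 hK; apply: ge_sup.
  by exists (rnorm (A 0)), 0 => //=; rewrite rnorm0.
move=> _ [x /= x1 <-]; apply: le_trans (hK x) _.
by rewrite -[leRHS]mulr1 ler_wpM2l.
Qed.

Lemma min_modulus_le T x : min_modulus T * rnorm x <= rnorm (T x).
Proof.
have [->|x0] := eqVneq x 0; first by rewrite linear0 rnorm0 mulr0.
have nx : 0 < rnorm x by rewrite rnorm_gt0.
rewrite -ler_pdivlMr // [leRHS]mulrC.
have -> : (rnorm x)^-1 * rnorm (T x) = rnorm (T ((rnorm x)^-1%:C *: x)).
  by rewrite linearZ rnormZr ger0_norm // invr_ge0 ltW.
apply: ge_inf; first by exists 0 => _ [y _ <-]; exact: rnorm_ge0.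
exists ((rnorm x)^-1%:C *: x) => //=.
by rewrite rnormZr ger0_norm ?invr_ge0 ?(ltW nx) // mulVf // gt_eqF.
Qed.

Lemma le_min_modulus (A : H -> H) (K : R) : (exists u : H, rnorm u = 1) ->
  (forall x, rnorm x = 1 -> K <= rnorm (A x)) -> K <= min_modulus A.
Proof.
move=> [u u1] hK; apply: lb_le_inf; first by exists (rnorm (A u)), u.
by move=> _ [x /= x1 <-]; exact: hK.
Qed.

Lemma min_modulus_le_opnorm T : (exists u : H, rnorm u = 1) ->
  bounded_operator T -> 0 <= min_modulus T <= opnorm T.
Proof.
move=> exu Tb; apply/andP; split.
  by apply: le_min_modulus => // x _; exact: rnorm_ge0.
have [u u1] := exu; have := min_modulus_le T u; rewrite u1 mulr1 => /le_trans.
apply.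
by have := rnorm_le_opnorm u Tb; rewrite u1 mulr1.
Qed.

Lemma scaled_isometry_mem a (V : {linear H -> H}) :
  (forall x, rnorm (V x) = rnorm x) -> scaled_isometries H (a \*: V).
Proof.
move=> hV; exists a => //; exists V => //; split; first exact: linearP.
by move=> x; rewrite !normE hV.
Qed.

(** With K = ‖T - aV‖, the triangle inequality gives ‖T‖ <= K + |a| and m(T) >= |a| - K; subtracting
    eliminates |a|. *)
Lemma opnorm_sub_scaled_isometry T (A : H -> H) : (exists u : H, rnorm u = 1) ->
  bounded_operator T -> scaled_isometries H A ->
  (opnorm T - min_modulus T) / 2 <= opnorm (T \- A).
Proof.
move=> exu Tb [a _ [V [lV nV] <-]].
have rV x : rnorm (V x) = rnorm x by rewrite /rnorm nV.
pose al := complex.Re `|a|.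
have al0 : 0 <= al by rewrite -ler0c -normCE.
have [L hL] : exists L : {linear H -> H}, L =1 T \- a \*: V.
  apply: ex_linear => b x y; rewrite /= lV (linearP T) (scalerDr a) opprD addrACA.
  by rewrite scalerBr !scalerA [a * b]mulrC.
have Lb : bounded_operator L.
  have [K hK] := Tb; exists (K + al) => x; rewrite hL /=.
  apply: le_trans (rnormD _ _) _; rewrite rnormN rnormZ rV mulrDl.
  by rewrite lerD2r.
have <- : (L : H -> H) = T \- a \*: V by apply/funext.
have hx x : rnorm (T x - a *: V x) <= opnorm L * rnorm x.
  by have := rnorm_le_opnorm x Lb; rewrite hL.
have K0 : 0 <= opnorm L.
  by have [u u1] := exu; have := le_trans (rnorm_ge0 _) (hx u); rewrite u1 mulr1.
have h1 : opnorm T <= opnorm L + al.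
  apply: opnorm_le => [|x]; first by rewrite addr_ge0.
  rewrite -(subrK (a *: V x) (T x)); apply: le_trans (rnormD _ _) _.
  by rewrite mulrDl rnormZ rV lerD2r.
have h2 : al - opnorm L <= min_modulus T.
  apply: le_min_modulus => // x x1.
  have := rnormB (a *: V x) (T x); rewrite rnormZ rV x1 mulr1 rnormBC -/al.
  have := hx x; rewrite x1 mulr1; lra.
lra.
Qed.

Lemma ex_near_scaled_isometry T (e : R) :
  separable H -> (exists u : H, rnorm u = 1) ->
  bounded_operator T -> ~ closed (range T) \/ index_le0 dot T -> 0 < e ->
  exists2 A : H -> H, scaled_isometries H A &
    opnorm (T \- A) <= (opnorm T - min_modulus T) / 2 + e.
Proof.
move=> Hsep exu Tb hT e0; have /andP[m0 mM] := min_modulus_le_opnorm exu Tb.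
have M0 := le_trans m0 mM; have [u u1] := exu.
case: (ltgtP 0 (min_modulus T)) m0 => // [mpos _|meq _].
  have hb x : min_modulus T * rnorm x <= rnorm (T x) <= opnorm T * rnorm x.
    by rewrite min_modulus_le rnorm_le_opnorm.
  have [V [V1 hV]] := isometry_near dotE mpos mM hb.
  exists (((opnorm T + min_modulus T) / 2)%:C \*: V).
    exact: scaled_isometry_mem.
  apply: le_trans (opnorm_le _ hV) _; first by rewrite divr_ge0 ?subr_ge0.
  by rewrite lerDl ltW.
(* Then ‖T - S‖ <= e/2, so ‖S‖ <= ‖T‖ + e/2, and the isometry step costs at most ‖T‖/2 + e/4; the
   total stays below ‖T‖/2 + e. *)
have d0 : 0 < e / 4 by rewrite divr_gt0.
have [S [[c c0 hc] ST]] := bounded_below_approx dotE Hsep Tb hT d0.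
pose M := opnorm T + e / 2.
have hS x : c * rnorm x <= rnorm (S x) <= M * rnorm x.
  rewrite hc //= -(subKr (T x) (S x)); apply: le_trans (rnormD _ _) _.
  have := ST x; have := rnorm_le_opnorm x Tb; rewrite rnormN /M; lra.
have cM : c <= M by have /andP[] := hS u; rewrite u1 !mulr1; apply: le_trans.
have [V [V1 hV]] := isometry_near dotE c0 cM hS.
exists (((M + c) / 2)%:C \*: V); first exact: scaled_isometry_mem.
apply: opnorm_le => [|x]; first by rewrite -meq subr0 addr_ge0 ?divr_ge0 ?(ltW e0).
rewrite /= -(subrKA (S x)); apply: le_trans (rnormD _ _) _.
have := ST x; have := hV x; have := rnorm_ge0 x; rewrite -meq /M; nra.
Qed.

Lemma op_dist_scaled_isometries T : separable H -> (exists u : H, rnorm u = 1) ->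
  bounded_operator T -> ~ closed (range T) \/ index_le0 dot T ->
  op_dist T (scaled_isometries H) = (opnorm T - min_modulus T) / 2.
Proof.
move=> Hsep exu Tb hT; apply/le_anti/andP; split; last first.
  apply: lb_le_inf.
    have [A hA _] := ex_near_scaled_isometry Hsep exu Tb hT ltr01.
    by exists (opnorm (T \- A)), A.
  by move=> _ [A hA <-]; exact: opnorm_sub_scaled_isometry.
apply/ler_addgt0Pr => e e0.
have [A hA hle] := ex_near_scaled_isometry Hsep exu Tb hT e0.
apply: le_trans hle; apply: ge_inf; last by exists A.
exists ((opnorm T - min_modulus T) / 2) => _ [B hB <-].
exact: opnorm_sub_scaled_isometry.
Qed.

Lemma rdot_le_dot x y : rdot x y <= complex.Re `|dot x y|.
Proof.
apply: le_trans (ler_norm _) _; rewrite -lecR -normCE.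
exact: normc_ge_Re.
Qed.

(* Multiplying x by a phase makes <x, y> real; then x + y and x - y are
   orthogonal. *)
Lemma AOP_unit_le T eps x y : 0 <= eps -> AOP dot eps T ->
  rnorm x = 1 -> rnorm y = 1 ->
  (1 - eps) * rnorm (T x) ^+ 2 <= (1 + eps) * rnorm (T y) ^+ 2.
Proof.
move=> eps0 hT x1 y1; have [w w1 wxy] := phase_exists (dot x y).
have nw z : rnorm (w *: z) = rnorm z by rewrite rnormZ w1 mul1r.
have real_xy : dot y (w *: x) = dot (w *: x) y.
  by rewrite dotC dotZl wxy normCE conjc_real.
have ort : dot (w *: x + y) (w *: x - y) = 0.
  rewrite dotBr !dotDl real_xy (dotE (w *: x)) (dotE y) !normE nw x1 y1.
  by rewrite opprD addrACA addrA subrK subrr.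
have := hT _ _ ort; rewrite normCE !normE -!rmorphM lecR.
move=> /(le_trans (rdot_le_dot _ _)).
rewrite linearD linearB !rdotE (rdotC dot (T y)) !(rdotxx dotE).
have := rnorm_sqrD dotE (T (w *: x)) (T y).
have := rnorm_sqrB dotE (T (w *: x)) (T y).
rewrite linearZ /= nw.
move: (rnorm (w *: T x - T y)) (rnorm (w *: T x + T y)) (rdot (w *: T x) (T y)).
move: (rnorm (T x)) (rnorm (T y)) => s t p q c hp hq h.
have : eps * (2 * (p * q)) <= eps * (p ^+ 2 + q ^+ 2).
  by rewrite ler_wpM2l //; have := sqr_ge0 (p - q); nra.
by rewrite hp hq; nra.
Qed.

(* Wielandt's inequality; after rescaling, T x and T y have the same norm and a
   nonnegative inner product, and T (x + y), T (x - y) are compared with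
   x + y, x - y. *)
Lemma wielandt T (m M : R) x y : 0 <= m ->
  (forall z, m * rnorm z <= rnorm (T z) <= M * rnorm z) -> dot x y = 0 ->
  (M ^+ 2 + m ^+ 2) * complex.Re `|dot (T x) (T y)| <=
  (M ^+ 2 - m ^+ 2) * (rnorm (T x) * rnorm (T y)).
Proof.
move=> m0 hT xy; have [w w1 wxy] := phase_exists (dot (T x) (T y)).
have [Tx0|Tx0] := eqVneq (T x) 0.
  by rewrite Tx0 dot0l normr0 rnorm0 mul0r !mulr0.
have [Ty0|Ty0] := eqVneq (T y) 0.
  by rewrite Ty0 dot0r normr0 rnorm0 !mulr0.
pose X := (rnorm (T y))%:C *: (w *: x); pose Y := (rnorm (T x))%:C *: y.
have xTp : 0 < rnorm (T x) by rewrite rnorm_gt0.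
have yTp : 0 < rnorm (T y) by rewrite rnorm_gt0.
pose p := rnorm (T x) * rnorm (T y); have p0 : 0 < p by rewrite mulr_gt0.
have nX : rnorm (T X) = p.
  by rewrite !linearZ /= rnormZr rnormZ w1 mul1r ger0_norm ?(ltW yTp) // mulrC.
have nY : rnorm (T Y) = p by rewrite linearZ rnormZr ger0_norm ?(ltW xTp).
pose c := complex.Re `|dot (T x) (T y)|.
have cXY : rdot (T X) (T Y) = p * c.
  by rewrite !linearZ /= rdotZl rdotZr /re_dot dotZl wxy mulrA [p]mulrC.
have XY : dot X Y = 0 by rewrite !(dotZl, dotZr) xy !mulr0.
have XYm : dot X (- Y) = 0 by rewrite -sub0r dotBr dot0r XY subr0.
have sqT z : m ^+ 2 * rnorm z ^+ 2 <= rnorm (T z) ^+ 2 <= M ^+ 2 * rnorm z ^+ 2.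
  have /andP[h1 h2] := hT z; rewrite -!exprMn.
  have h0 : 0 <= m * rnorm z by rewrite mulr_ge0 ?rnorm_ge0.
  by rewrite !ler_pXn2r ?nnegrE ?rnorm_ge0 ?(le_trans h0 (le_trans h1 h2)) ?h1.
have /andP[_] := sqT (X + Y); have /andP[+ _] := sqT (X - Y).
rewrite (linearB T) (linearD T) (rnorm_sqrB dotE (T X)) (rnorm_sqrD dotE (T X)).
rewrite (rnorm_sqrD0 dotE XY) (rnorm_sqrD0 dotE XYm) rnormN nX nY cXY -/c -/p.
set s := _ + rnorm Y ^+ 2 => h1 h2.
have m2 : 0 <= m ^+ 2 by rewrite sqr_ge0.
have M2 : 0 <= M ^+ 2 by rewrite sqr_ge0.
have h3 := ler_wpM2l M2 h1; have h4 := ler_wpM2l m2 h2.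
suff : 0 <= p * ((M ^+ 2 - m ^+ 2) * p - (M ^+ 2 + m ^+ 2) * c).
  by rewrite pmulr_rge0 // subr_ge0.
by move: h3 h4; move: (m ^+ 2) (M ^+ 2) => m' M'; nra.
Qed.

(** Wielandt's inequality makes the quotient admissible. Conversely, for an admissible e,
    [AOP_unit_le] bounds the ratio of any two values of ‖Tx‖ on the unit sphere, hence that of ‖T‖
    and m(T). *)
Lemma AOP_constE T : (exists u : H, rnorm u = 1) -> bounded_operator T ->
  0 < opnorm T -> AOP_const dot T =
  (opnorm T ^+ 2 - min_modulus T ^+ 2) / (opnorm T ^+ 2 + min_modulus T ^+ 2).
Proof.
move=> exu Tb M0; have /andP[m0 mM] := min_modulus_le_opnorm exu Tb.
set M := opnorm T; set m := min_modulus T.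
have M2 : 0 < M ^+ 2 by rewrite exprn_gt0.
have m2 : 0 <= m ^+ 2 by rewrite sqr_ge0.
have mM2 : m ^+ 2 <= M ^+ 2 by rewrite ler_pXn2r ?nnegrE // ltW.
have D0 : 0 < M ^+ 2 + m ^+ 2 by rewrite ltr_wpDr.
set eps := _ / _.
have eps01 : 0 <= eps <= 1.
  by rewrite divr_ge0 ?subr_ge0 ?(ltW D0) //= ler_pdivrMr // mul1r; lra.
have epsT : AOP dot eps T.
  move=> x y xy; rewrite normCE !normE -!rmorphM lecR -mulrA /eps mulrAC.
  rewrite ler_pdivlMr // mulrC; apply: wielandt => // z.
  by rewrite min_modulus_le rnorm_le_opnorm.
apply/le_anti/andP; split.
  by apply: ge_inf; [exists 0 => e [/andP[]] | split].
apply: lb_le_inf; first by exists eps; split.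
move=> e [/andP[e0 e1] eT]; rewrite ler_pdivrMr //.
(* For e = 1 the denominator below would vanish, but then the bound is immediate. *)
have [->|ne1] := eqVneq e 1; first by rewrite mul1r; lra.
have e1' : 0 < 1 - e by rewrite subr_gt0 lt_neqAle ne1.
pose q := Num.sqrt ((1 + e) / (1 - e)).
have q2 : q ^+ 2 = (1 + e) / (1 - e).
  by rewrite sqr_sqrtr // divr_ge0 ?(ltW e1') // addr_ge0.
have q0 : 0 < q by rewrite sqrtr_gt0 divr_gt0 // ltr_pwDl.
have hq x y : rnorm x = 1 -> rnorm y = 1 -> rnorm (T x) <= q * rnorm (T y).
  move=> x1 y1; have h := AOP_unit_le e0 eT x1 y1.
  rewrite -(ler_pXn2r (n := 2)) ?nnegrE ?mulr_ge0 ?rnorm_ge0 ?(ltW q0) //.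
  by rewrite exprMn q2 mulrAC ler_pdivlMr // mulrC.
(* The infimum over y is taken first, with x fixed inside the operator norm afterwards. *)
have Mq : M <= q * m.
  rewrite mulrC -ler_pdivrMr //; apply: le_min_modulus => // y y1.
  rewrite ler_pdivrMr // mulrC; apply: opnorm_le => [|x].
    by rewrite mulr_ge0 ?rnorm_ge0 ?(ltW q0).
  have [->|x0] := eqVneq x 0; first by rewrite linear0 rnorm0 mulr0.
  have nx : 0 < rnorm x by rewrite rnorm_gt0.
  rewrite -ler_pdivrMr // [leLHS]mulrC.
  have -> : (rnorm x)^-1 * rnorm (T x) = rnorm (T (normalize x)).
    by rewrite linearZ rnormZr ger0_norm // invr_ge0 ltW.
  by apply: hq => //; exact: rnorm_normalize.
have : M ^+ 2 <= (q * m) ^+ 2.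
  by rewrite ler_pXn2r ?nnegrE ?mulr_ge0 ?(ltW q0) ?(ltW M0).
rewrite exprMn q2 mulrAC ler_pdivlMr //.
by move: (M ^+ 2) (m ^+ 2) => M' m'; nra.
Qed.

(** Solving the formula of [AOP_constE] for m gives (1 - eps)/(1 + eps) = (m/M)^2. *)
Lemma min_modulus_AOP_const T : (exists u : H, rnorm u = 1) -> bounded_operator T ->
  min_modulus T =
  Num.sqrt ((1 - AOP_const dot T) / (1 + AOP_const dot T)) * opnorm T.
Proof.
move=> exu Tb; have /andP[m0 mM] := min_modulus_le_opnorm exu Tb.
(* For T = 0 both sides vanish, whatever the value of the AOP constant. *)
have [M0|M0] := eqVneq (opnorm T) 0.
  by rewrite M0 mulr0; apply/le_anti; rewrite m0 -M0 mM.
have Mp : 0 < opnorm T by rewrite lt_def M0 (le_trans m0).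
have D0 : opnorm T ^+ 2 + min_modulus T ^+ 2 != 0.
  by rewrite gt_eqF // ltr_wpDr ?sqr_ge0 // exprn_gt0.
rewrite (AOP_constE exu Tb Mp).
have -> : forall m M : R, M != 0 -> M ^+ 2 + m ^+ 2 != 0 ->
    (1 - (M ^+ 2 - m ^+ 2) / (M ^+ 2 + m ^+ 2)) /
    (1 + (M ^+ 2 - m ^+ 2) / (M ^+ 2 + m ^+ 2)) = (m / M) ^+ 2 => //.
  move=> m M nM nD; field; rewrite nM nD /=.
  by rewrite addrACA subrr addr0 -mulr2n mulrn_eq0 /= expf_neq0.
by rewrite sqrtr_sqr ger0_norm ?divr_ge0 ?(ltW Mp) // divfK.
Qed.

End DistanceAOP.

Theorem corollary3p6 (R : realType) (H : completeNormedModType R[i])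
    (dot : {dot H for @Num.conj R[i]}) (dotE : norm_induced_by dot)
    (Hsep : separable H) (Hdim : hdim_ge dot [set: H] 2)
    (T : {linear H -> H}) (Tbd : bounded_operator T) :
  ~ closed (range T) \/ index_le0 dot T ->
  op_dist T (scaled_isometries H) = (opnorm T - min_modulus T) / 2 /\
  (opnorm T - min_modulus T) / 2 =
    (1 - Num.sqrt ((1 - AOP_const dot T) / (1 + AOP_const dot T))) / 2
      * opnorm T.
Proof.
move=> hT; have exu := ex_unit_vector Hdim; split.
  exact: (op_dist_scaled_isometries dotE).
by rewrite {1}(min_modulus_AOP_const dotE exu Tbd); field.
Qed.
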